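(* Let $\lambda,T,L_1,L_2>0$, let $k_h,k_\tau$ be fixed positive integers, and let $u$ be the exact solution of $$u_t+u(u_x+u_y)-\lambda\Delta u=0\ \ ((x,y)\in\mathbb{R}^2,\ 0<t\le T),\qquad u(x,y,0)=u_0(x,y),$$ $$u(x,y,t)=u(x+L_1,y,t),\quad u(x,y,t)=u(x,y+L_2,t),$$ with $v=u_{xx}$, $w=u_{yy}$, where $u$ has the regularity stated in the context. Put $$c_0=\max_{(x,y,t)\in\bar\Omega\times[0,T]}\big\{|u|,\ |u_x+u_y|,\ |u_{xx}|,\ |u_{yy}|\big\},\qquad \Omega=(0,L_1)\times(0,L_2),$$ $$c_1=\frac{c_0}{6}+\frac{h_f^2c_0}{4}+\frac{h_fc_0}{2}+\lambda+\frac12 .$$ Let $\{u_{ij}^n,v_{ij}^n,w_{ij}^n\}$ be the solution of the fine-grid linear system (Step 3 in the context) of the space-time two-grid compact difference scheme, and $e_{ij}^n=u(x_i,y_j,t_n)-u_{ij}^n$. Then there is a constant $\widetilde C>0$, independent of the temporal and spatial step sizes, such that whenever $\tau_f\le \frac{2}{3c_1}$, $$\|e^n\|\le\widetilde C(\tau_f^2+h_f^4),\qquad 1\le n\le N^f.$$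
   Context: **Grids.** $M_1^c,M_2^c,N^c,k_h,k_\tau$ are positive integers with $L_1=h_cM_1^c$, $L_2=h_cM_2^c$ for a common coarse spatial step $h_c>0$, and $\tau_c=T/N^c$. The fine grid has $h_f=h_c/k_h$, $\tau_f=\tau_c/k_\tau$, $M_1^f=k_hM_1^c$, $M_2^f=k_hM_2^c$, $N^f=k_\tau N^c$. For $\sigma\in\{c,f\}$, the grid points are $x_a=ah_\sigma$, $y_b=bh_\sigma$, $t_d=d\tau_\sigma$; $\Omega_h^\sigma=\{(x_a,y_b):1\le a\le M_1^\sigma,\,1\le b\le M_2^\sigma\}$, $\Omega_\tau^\sigma=\{t_d:0\le d\le N^\sigma\}$. $\mathcal{V}_h^\sigma$ is the space of real grid functions $v=\{v_{ab}\}_{a,b\in\mathbb{Z}}$ with $v_{a+M_1^\sigma,b}=v_{ab}$, $v_{a,b+M_2^\sigma}=v_{ab}$. The fine-grid norm is $\|v\|=\big(h_f^2\sum_{a=1}^{M_1^f}\sum_{b=1}^{M_2^f}v_{ab}^2\big)^{1/2}$. **Difference operators** ($\sigma\in\{c,f\}$). $v_{ab}^{d-\frac12}=\frac12(v_{ab}^d+v_{ab}^{d-1})$, $\delta_t^\sigma v_{ab}^{d-\frac12}=\frac1{\tau_\sigma}(v_{ab}^d-v_{ab}^{d-1})$, $\widehat\delta_x^\sigma v_{ab}=\frac{1}{2h_\sigma}(v_{a+1,b}-v_{a-1,b})$, $\widehat\delta_y^\sigma v_{ab}=\frac{1}{2h_\sigma}(v_{a,b+1}-v_{a,b-1})$,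 $\widehat\delta_h^\sigma=\widehat\delta_x^\sigma+\widehat\delta_y^\sigma$, $\delta_{xx}^\sigma v_{ab}=\frac1{h_\sigma^2}(v_{a+1,b}-2v_{ab}+v_{a-1,b})$, $\delta_{yy}^\sigma v_{ab}=\frac1{h_\sigma^2}(v_{a,b+1}-2v_{ab}+v_{a,b-1})$. With $(uv)_{ab}=u_{ab}v_{ab}$, the bilinear operators are $\psi_\ast^\sigma(u,v)_{ab}=\frac13\big(u_{ab}\widehat\delta_\ast^\sigma v_{ab}+\widehat\delta_\ast^\sigma(uv)_{ab}\big)$ for $\ast\in\{x,y,h\}$. **Regularity of the exact solution.** $u\in C^{4,2}(\bar\Omega\times[0,T])$ (continuous spatial partial derivatives up to order 4 and time derivatives up to order 2), and $u$ is smooth enough that the scheme is consistent in the following sense: with $U_{ab}^d=u(x_a,y_b,t_d)$, $V_{ab}^d=u_{xx}(x_a,y_b,t_d)$, $W_{ab}^d=u_{yy}(x_a,y_b,t_d)$ on each grid $\sigma\in\{c,f\}$, the quantities $P_\sigma,Q_\sigma,R_\sigma$ defined by $$\delta_t^\sigma U_{ab}^{d-\frac12}+\psi_h^\sigma(U^{d-\frac12},U^{d-\frac12})_{ab}-\tfrac{h_\sigma^2}{2}\big[\psi_x^\sigma(V^{d-\frac12},U^{d-\frac12})_{ab}+\psi_y^\sigma(W^{d-\frac12},U^{d-\frac12})_{ab}\big]=\lambda(V_{ab}^{d-\frac12}+W_{ab}^{d-\frac12})+(P_\sigma)_{ab}^{d-\frac12},$$ $$V_{ab}^d=\delta_{xx}^\sigma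 U_{ab}^d-\tfrac{h_\sigma^2}{12}\delta_{xx}^\sigma V_{ab}^d+(Q_\sigma)_{ab}^d,\qquad W_{ab}^d=\delta_{yy}^\sigma U_{ab}^d-\tfrac{h_\sigma^2}{12}\delta_{yy}^\sigma W_{ab}^d+(R_\sigma)_{ab}^d$$ satisfy $|(P_\sigma)_{ab}^{d-\frac12}|\le C(\tau_\sigma^2+h_\sigma^4)$ and $|(Q_\sigma)_{ab}^d|,|(R_\sigma)_{ab}^d|\le Ch_\sigma^4$ with $C$ independent of the step sizes. **Step 1 (coarse nonlinear scheme).** $(u_c)^r,(v_c)^r,(w_c)^r\in\mathcal{V}_h^c$, $0\le r\le N^c$, solve, for all $(x_p,y_q)\in\Omega_h^c$, $$\delta_t^c(u_c)_{pq}^{r-\frac12}+\psi_h^c\big(u_c^{r-\frac12},u_c^{r-\frac12}\big)_{pq}-\frac{h_c^2}{2}\Big[\psi_x^c\big(v_c^{r-\frac12},u_c^{r-\frac12}\big)_{pq}+\psi_y^c\big(w_c^{r-\frac12},u_c^{r-\frac12}\big)_{pq}\Big]=\lambda\big((v_c)_{pq}^{r-\frac12}+(w_c)_{pq}^{r-\frac12}\big)\quad(1\le r\le N^c),$$ $(v_c)_{pq}^r=\delta_{xx}^c(u_c)_{pq}^r-\frac{h_c^2}{12}\delta_{xx}^c(v_c)_{pq}^r$ and $(w_c)_{pq}^r=\delta_{yy}^c(u_c)_{pq}^r-\frac{h_c^2}{12}\delta_{yy}^c(w_c)_{pq}^r$ for $0\le r\le N^c$, and $(u_c)_{pq}^0=u_0(x_p,y_q)$.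 **Step 2 (interpolation).** In time, at coarse spatial nodes: $(u_f)_{pk_h,qk_h}^{(r-1)k_\tau+s}=(1-\frac{s}{k_\tau})(u_c)_{pq}^{r-1}+\frac{s}{k_\tau}(u_c)_{pq}^r$ for $1\le r\le N^c$, $0\le s\le k_\tau$. In space, for $0\le n\le N^f$, $0\le p\le M_1^c-1$, $0\le q\le M_2^c-1$, $0\le l,m\le k_h-1$: $$(u_f)_{pk_h+l,qk_h+m}^n=\sum_{i=0}^3\sum_{j=0}^3(u_f)_{(p+i)k_h,(q+j)k_h}^n\,\mu_i(x_{pk_h+l})\,\omega_j(y_{qk_h+m}),$$ $$\mu_i(x)=\prod_{0\le s\le3,\,s\ne i}\frac{x-x_{(p+s)k_h}}{x_{(p+i)k_h}-x_{(p+s)k_h}},\qquad \omega_j(y)=\prod_{0\le s\le3,\,s\ne j}\frac{y-y_{(q+s)k_h}}{y_{(q+j)k_h}-y_{(q+s)k_h}},$$ with fine-grid nodes $x_a=ah_f$, $y_b=bh_f$ and values extended periodically, so $u_f^n\in\mathcal{V}_h^f$. Then $v_f^n,w_f^n\in\mathcal{V}_h^f$ are defined by $(v_f)_{ij}^n=\delta_{xx}^f(u_f)_{ij}^n-\frac{h_f^2}{12}\delta_{xx}^f(v_f)_{ij}^n$ and $(w_f)_{ij}^n=\delta_{yy}^f(u_f)_{ij}^n-\frac{h_f^2}{12}\delta_{yy}^f(w_f)_{ij}^n$. **Step 3 (fine linear scheme).** $u^n,v^n,w^n\in\mathcal{V}_h^f$, $0\le n\le N^f$, solve, for all $(x_i,y_j)\in\Omega_h^f$,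 $$\delta_t^f u_{ij}^{n-\frac12}+\psi_h^f\big(u_f^{n-\frac12},u^{n-\frac12}\big)_{ij}-\frac{h_f^2}{2}\Big[\psi_x^f\big(v_f^{n-\frac12},u^{n-\frac12}\big)_{ij}+\psi_y^f\big(w_f^{n-\frac12},u^{n-\frac12}\big)_{ij}\Big]=\lambda\big(v_{ij}^{n-\frac12}+w_{ij}^{n-\frac12}\big)\quad(1\le n\le N^f),$$ $v_{ij}^n=\delta_{xx}^fu_{ij}^n-\frac{h_f^2}{12}\delta_{xx}^fv_{ij}^n$ and $w_{ij}^n=\delta_{yy}^fu_{ij}^n-\frac{h_f^2}{12}\delta_{yy}^fw_{ij}^n$ for $0\le n\le N^f$, and $u_{ij}^0=u_0(x_i,y_j)$. *)

(* Defs.v *)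
From Stdlib Require Export Reals ZArith List.
From Coquelicot Require Export Coquelicot.
Open Scope R_scope.

(** * The exact solution *)

(** Functions of [(x, y, t)] are total, but only their values on
    [R^2 x [0, T]] matter.  Space derivatives are two-sided; time derivatives
    are taken relative to [[0, T]], so they are one-sided at [0] and [T]. *)

Definition strip (T : R) (p : R * R * R) : Prop := 0 <= snd p <= T.

Definition continuous_strip (T : R) (f : R -> R -> R -> R) : Prop :=
  continuous_on (strip T)
    (fun p : R * R * R => f (fst (fst p)) (snd (fst p)) (snd p)).

Definition is_deriv_x (T : R) (f g : R -> R -> R -> R) : Prop :=
  forall x y t, 0 <= t <= T -> is_derive (fun z => f z y t) x (g x y t).

Definition is_deriv_y (T : R) (f g : R -> R -> R -> R) : Prop :=
  forall x y t, 0 <= t <= T -> is_derive (fun z => f x z t) y (g x y t).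

Definition is_deriv_t (T : R) (f g : R -> R -> R -> R) : Prop :=
  forall x y t, 0 <= t <= T ->
    D_in (fun s => f x y s) (fun s => g x y s) (fun s => 0 <= s <= T) t.

Fixpoint C_space (T : R) (k : nat) (f : R -> R -> R -> R) : Prop :=
  continuous_strip T f /\
  match k with
  | O => True
  | S k' => exists fx fy,
      is_deriv_x T f fx /\ is_deriv_y T f fy /\
      C_space T k' fx /\ C_space T k' fy
  end.

Fixpoint C_time (T : R) (k : nat) (f : R -> R -> R -> R) : Prop :=
  continuous_strip T f /\
  match k with
  | O => True
  | S k' => exists ft, is_deriv_t T f ft /\ C_time T k' ft
  end.

(** For a function that is periodic with cell [Omega], having continuous
    derivatives on [closure Omega x [0, T]] is the same as having them on
    [R^2 x [0, T]], which is the form used here. *)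
Definition C42 (T : R) (u : R -> R -> R -> R) : Prop :=
  C_space T 4 u /\ C_time T 2 u.

Definition Dx (u : R -> R -> R -> R) : R -> R -> R -> R :=
  fun x y t => Derive (fun z => u z y t) x.
Definition Dy (u : R -> R -> R -> R) : R -> R -> R -> R :=
  fun x y t => Derive (fun z => u x z t) y.
Definition Dxx (u : R -> R -> R -> R) : R -> R -> R -> R :=
  fun x y t => Derive_n (fun z => u z y t) 2 x.
Definition Dyy (u : R -> R -> R -> R) : R -> R -> R -> R :=
  fun x y t => Derive_n (fun z => u x z t) 2 y.

Definition exact_solution (lambda T L1 L2 : R) (u0 : R -> R -> R)
    (u : R -> R -> R -> R) : Prop :=
  (exists ut, is_deriv_t T u ut /\
     forall x y t, 0 < t <= T ->
       ut x y t + u x y t * (Dx u x y t + Dy u x y t)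
         - lambda * (Dxx u x y t + Dyy u x y t) = 0) /\
  (forall x y, u x y 0 = u0 x y) /\
  (forall x y t, 0 <= t <= T ->
     u x y t = u (x + L1) y t /\ u x y t = u x (y + L2) t).

Definition is_max (E : R -> Prop) (m : R) : Prop :=
  E m /\ forall r, E r -> r <= m.

Definition is_c0 (T L1 L2 : R) (u : R -> R -> R -> R) (c0 : R) : Prop :=
  is_max (fun r => exists x y t,
            0 <= x <= L1 /\ 0 <= y <= L2 /\ 0 <= t <= T /\
            (r = Rabs (u x y t) \/ r = Rabs (Dx u x y t + Dy u x y t) \/
             r = Rabs (Dxx u x y t) \/ r = Rabs (Dyy u x y t))) c0.

Definition c_1 (lambda c0 hf : R) : R :=
  c0 / 6 + hf ^ 2 * c0 / 4 + hf * c0 / 2 + lambda + 1 / 2.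

(** * Grids, grid functions and difference operators *)

Definition is_grid (L1 L2 T h tau : R) (M1 M2 N : nat) : Prop :=
  (1 <= M1)%nat /\ (1 <= M2)%nat /\ (1 <= N)%nat /\ 0 < h /\
  L1 = h * INR M1 /\ L2 = h * INR M2 /\ tau = T / INR N.

Definition gridfun := Z -> Z -> R.

Definition periodic (M1 M2 : nat) (v : gridfun) : Prop :=
  forall a b, v (a + Z.of_nat M1)%Z b = v a b /\ v a (b + Z.of_nat M2)%Z = v a b.

Definition in_Omega (M1 M2 : nat) (a b : Z) : Prop :=
  (1 <= a <= Z.of_nat M1)%Z /\ (1 <= b <= Z.of_nat M2)%Z.

Definition sample (h tau : R) (g : R -> R -> R -> R) : nat -> gridfun :=
  fun d a b => g (IZR a * h) (IZR b * h) (INR d * tau).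

Definition norm_h (h : R) (M1 M2 : nat) (v : gridfun) : R :=
  sqrt (h ^ 2 *
    sum_n_m (fun a => sum_n_m (fun b => v (Z.of_nat a) (Z.of_nat b) ^ 2) 1 M2) 1 M1).

(** [mid v d] and [delta_t tau v d] live at time level [d - 1/2], [d >= 1]. *)
Definition mid (v : nat -> gridfun) (d : nat) : gridfun :=
  fun a b => (v d a b + v (d - 1)%nat a b) / 2.

Definition delta_t (tau : R) (v : nat -> gridfun) (d : nat) : gridfun :=
  fun a b => (v d a b - v (d - 1)%nat a b) / tau.

Definition hat_x (h : R) (v : gridfun) : gridfun :=
  fun a b => (v (a + 1)%Z b - v (a - 1)%Z b) / (2 * h).
Definition hat_y (h : R) (v : gridfun) : gridfun :=
  fun a b => (v a (b + 1)%Z - v a (b - 1)%Z) / (2 * h).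
Definition hat_h (h : R) (v : gridfun) : gridfun :=
  fun a b => hat_x h v a b + hat_y h v a b.

Definition delta_xx (h : R) (v : gridfun) : gridfun :=
  fun a b => (v (a + 1)%Z b - 2 * v a b + v (a - 1)%Z b) / h ^ 2.
Definition delta_yy (h : R) (v : gridfun) : gridfun :=
  fun a b => (v a (b + 1)%Z - 2 * v a b + v a (b - 1)%Z) / h ^ 2.

Definition psi (hat : gridfun -> gridfun) (u v : gridfun) : gridfun :=
  fun a b => / 3 * (u a b * hat v a b + hat (fun i j => u i j * v i j) a b).
Definition psi_x (h : R) := psi (hat_x h).
Definition psi_y (h : R) := psi (hat_y h).
Definition psi_h (h : R) := psi (hat_h h).

(** * The schemes *)

(** Left-hand side minus right-hand side of the momentum equation at level
    [d - 1/2], with advecting fields [U, V, W] and unknowns [u, v, w]: the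
    nonlinear scheme has [(U, V, W) = (u, v, w)]. *)
Definition momentum (lambda h tau : R) (U V W u v w : nat -> gridfun)
    (d : nat) : gridfun :=
  fun a b =>
    delta_t tau u d a b + psi_h h (mid U d) (mid u d) a b
    - h ^ 2 / 2 * (psi_x h (mid V d) (mid u d) a b
                   + psi_y h (mid W d) (mid u d) a b)
    - lambda * (mid v d a b + mid w d a b).

Definition compact_x (h : R) (u v : gridfun) : gridfun :=
  fun a b => delta_xx h u a b - h ^ 2 / 12 * delta_xx h v a b.
Definition compact_y (h : R) (u w : gridfun) : gridfun :=
  fun a b => delta_yy h u a b - h ^ 2 / 12 * delta_yy h w a b.

Definition consistent (lambda T L1 L2 : R) (u : R -> R -> R -> R) : Prop :=
  exists C : R, forall (h tau : R) (M1 M2 N : nat),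
    is_grid L1 L2 T h tau M1 M2 N ->
    let U := sample h tau u in
    let V := sample h tau (Dxx u) in
    let W := sample h tau (Dyy u) in
    (forall d a b, (1 <= d <= N)%nat ->
       Rabs (momentum lambda h tau U V W U V W d a b) <= C * (tau ^ 2 + h ^ 4)) /\
    (forall d a b, (d <= N)%nat ->
       Rabs (V d a b - compact_x h (U d) (V d) a b) <= C * h ^ 4 /\
       Rabs (W d a b - compact_y h (U d) (W d) a b) <= C * h ^ 4).

Definition in_V (M1 M2 N : nat) (v : nat -> gridfun) : Prop :=
  forall n, (n <= N)%nat -> periodic M1 M2 (v n).

Definition compact_relations (h : R) (M1 M2 N : nat) (u v w : nat -> gridfun) : Prop :=
  forall n a b, (n <= N)%nat -> in_Omega M1 M2 a b ->
    v n a b = compact_x h (u n) (v n) a b /\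
    w n a b = compact_y h (u n) (w n) a b.

Definition scheme_solution (lambda h tau : R) (M1 M2 N : nat) (u0 : R -> R -> R)
    (U V W u v w : nat -> gridfun) : Prop :=
  in_V M1 M2 N u /\ in_V M1 M2 N v /\ in_V M1 M2 N w /\
  (forall n a b, (1 <= n <= N)%nat -> in_Omega M1 M2 a b ->
     momentum lambda h tau U V W u v w n a b = 0) /\
  compact_relations h M1 M2 N u v w /\
  (forall a b, in_Omega M1 M2 a b -> u 0%nat a b = u0 (IZR a * h) (IZR b * h)).

Definition coarse_solution (lambda h tau : R) (M1 M2 N : nat) (u0 : R -> R -> R)
    (uc vc wc : nat -> gridfun) : Prop :=
  scheme_solution lambda h tau M1 M2 N u0 uc vc wc uc vc wc.

Definition fine_solution := scheme_solution.

(** [lagrange z i x] is the product over [s = 0..3], [s <> i], of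
    [(x - z s) / (z i - z s)]. *)
Definition lagrange (z : nat -> R) (i : nat) (x : R) : R :=
  fold_right Rmult 1
    (map (fun s => (x - z s) / (z i - z s))
       (filter (fun s => negb (Nat.eqb s i)) (seq 0 4))).

(** [M1], [M2], [N] are the coarse sizes and [hf] is the fine spatial step. *)
Definition interpolation (kh kt : nat) (hf : R) (M1 M2 N : nat)
    (uc uf : nat -> gridfun) : Prop :=
  let K := Z.of_nat kh in
  in_V (kh * M1) (kh * M2) (kt * N) uf /\
  (forall (r s : nat) (p q : Z),
     (1 <= r <= N)%nat -> (s <= kt)%nat -> in_Omega M1 M2 p q ->
     uf ((r - 1) * kt + s)%nat (p * K)%Z (q * K)%Z =
       (1 - INR s / INR kt) * uc (r - 1)%nat p q + INR s / INR kt * uc r p q) /\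
  (forall (n : nat) (p q l m : Z),
     (n <= kt * N)%nat ->
     (0 <= p <= Z.of_nat M1 - 1)%Z -> (0 <= q <= Z.of_nat M2 - 1)%Z ->
     (0 <= l <= K - 1)%Z -> (0 <= m <= K - 1)%Z ->
     uf n (p * K + l)%Z (q * K + m)%Z =
       sum_n_m (fun i => sum_n_m (fun j =>
         uf n ((p + Z.of_nat i) * K)%Z ((q + Z.of_nat j) * K)%Z
         * lagrange (fun s => IZR ((p + Z.of_nat s) * K) * hf) i (IZR (p * K + l) * hf)
         * lagrange (fun s => IZR ((q + Z.of_nat s) * K) * hf) j (IZR (q * K + m) * hf))
         0 3) 0 3).

Definition interpolated_fields (kh kt : nat) (hf : R) (M1 M2 N : nat)
    (uc uf vf wf : nat -> gridfun) : Prop :=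
  interpolation kh kt hf M1 M2 N uc uf /\
  in_V (kh * M1) (kh * M2) (kt * N) vf /\
  in_V (kh * M1) (kh * M2) (kt * N) wf /\
  compact_relations hf (kh * M1) (kh * M2) (kt * N) uf vf wf.

(* Main.v *)
From Stdlib Require Import Lra Lia Psatz ClassicalEpsilon Classical.
Require Import Defs.

(** Both schemes are linearised by the bilinearity of [psi]: with [e = U - u] the error
    and [eps = U - A] the error of the advecting field ([A = u] on the coarse grid, [A = uf]
    on the fine one),
      [psi(U, U) - psi(A, u) = psi(A, e) + psi(eps, U)].
    Testing with [e] kills [psi(A, e)] because [psi] is skew, whatever the size of [A], and a
    summation by parts bounds [psi(eps, U)] by [eps], [e] and the dissipation; the terms with
    [h^2 (V - B)] reduce to [eps] because the compact relation costs only two powers of [h].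
    Hence no maximum norm bound on a discrete solution is required, and an [l^2] bound for
    [eps] suffices: on the coarse grid [eps = e] is handled by Gronwall's inequality, on the
    fine grid [eps] is controlled by the coarse error and the interpolation errors.  Steps too
    large for Gronwall are covered by the unconditional stability of the schemes. *)

(** * Sums over a periodicity cell *)

(** A single convergence lemma, [scheme_convergence], serves both grids. Its hypothesis bounds the
    advecting error by [D * (E n + E (n - 1) + rho ^ 2)], which fits the feedback of the unknown
    error on the coarse grid as well as the known small field error on the fine one.

    The passage from coarse to fine loses no order because the refinement ratios are fixed:
    [tauc ^ 2 + hc ^ 4] is at most a multiple of [tauf ^ 2 + hf ^ 4] that depends only on [kh] and
    [kt]. Linear interpolation in time and cubic interpolation in space have just the matching
    orders 2 and 4.

    Constants stay uniform in the steps for two reasons. A period holds at least one cell, so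
    [h <= L1] and stray powers of [h] become powers of [L1]. The number of nodes occurs only
    multiplied by [h ^ 2], and this product is the area of the period cell.

    The unknowns and the advecting fields both satisfy the compact relations exactly. Hence the
    errors of both inherit the same defect, that of the exact solution, and one function [q] per
    direction describes it. *)

Fixpoint zsum (M : nat) (f : Z -> R) : R :=
  match M with
  | O => 0
  | S m => zsum m f + f (Z.of_nat m)
  end.

Lemma zsum_ext M f g :
  (forall a, (0 <= a < Z.of_nat M)%Z -> f a = g a) -> zsum M f = zsum M g.
Proof.
  induction M as [|M IH]; intros H; simpl; auto.
  rewrite IH by (intros; apply H; lia). rewrite H by lia. reflexivity.
Qed.

Lemma zsum_le M f g :
  (forall a, (0 <= a < Z.of_nat M)%Z -> f a <= g a) -> zsum M f <= zsum M g.
Proof.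
  induction M as [|M IH]; intros H; simpl; [lra|].
  apply Rplus_le_compat; [apply IH; intros; apply H; lia|apply H; lia].
Qed.

Lemma zsum_plus M f g : zsum M (fun a => f a + g a) = zsum M f + zsum M g.
Proof. induction M as [|M IH]; simpl; [|rewrite IH]; ring. Qed.

Lemma zsum_scal M c f : zsum M (fun a => c * f a) = c * zsum M f.
Proof. induction M as [|M IH]; simpl; [|rewrite IH]; ring. Qed.

Lemma zsum_const M c : zsum M (fun _ => c) = INR M * c.
Proof. induction M as [|M IH]; [simpl; ring|]. rewrite S_INR; simpl; rewrite IH; ring. Qed.

Lemma zsum_succ M f :
  zsum M (fun a => f (a + 1)%Z) = zsum M f + f (Z.of_nat M) - f 0%Z.
Proof.
  induction M as [|M IH]; [simpl; ring|].
  cbn [zsum]. rewrite IH.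
  replace (Z.of_nat (S M)) with (Z.of_nat M + 1)%Z by lia. ring.
Qed.

Lemma zsum_shift M f :
  (forall a, f (a + Z.of_nat M)%Z = f a) -> zsum M (fun a => f (a + 1)%Z) = zsum M f.
Proof. intros H. rewrite zsum_succ, <- (H 0%Z), Z.add_0_l. ring. Qed.

Lemma zsum_app M N f :
  zsum (M + N) f = zsum M f + zsum N (fun a => f (Z.of_nat M + a)%Z).
Proof.
  induction N as [|N IH]; [rewrite Nat.add_0_r; simpl; ring|].
  rewrite Nat.add_succ_r. cbn [zsum]. rewrite IH, Nat2Z.inj_add. ring.
Qed.

(** The quotient by [k] is constant on blocks of [k] consecutive indices. This is how a quantity
    attached to coarse cells is summed over fine nodes. *)
Lemma zsum_div k M f : (1 <= k)%nat ->
  zsum (k * M) (fun a => f (a / Z.of_nat k)%Z) = INR k * zsum M f.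
Proof.
  intros Hk. induction M as [|M IH]; [rewrite Nat.mul_0_r; simpl; ring|].
  replace (k * S M)%nat with (k * M + k)%nat by lia.
  rewrite zsum_app, IH. cbn [zsum].
  rewrite (zsum_ext k _ (fun _ => f (Z.of_nat M))).
  - rewrite zsum_const. ring.
  - intros a Ha. f_equal. symmetry.
    apply (Z.div_unique _ _ _ a); [left; lia|lia].
Qed.

Lemma sum_n_m_zsum M (f : Z -> R) :
  sum_n_m (fun a => f (Z.of_nat a)) 1 M = zsum M (fun a => f (a + 1)%Z).
Proof.
  induction M as [|M IH].
  - rewrite sum_n_m_zero by lia. reflexivity.
  - rewrite sum_n_Sm by lia. rewrite IH. cbn [zsum]. unfold plus; simpl.
    do 2 f_equal. lia.
Qed.

Definition cell_sum (M1 M2 : nat) (f : gridfun) : R :=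
  zsum M1 (fun a => zsum M2 (fun b => f a b)).

Lemma cell_sum_ext_in M1 M2 f g :
  (forall a b, (0 <= a < Z.of_nat M1)%Z -> (0 <= b < Z.of_nat M2)%Z -> f a b = g a b) ->
  cell_sum M1 M2 f = cell_sum M1 M2 g.
Proof. intros H. apply zsum_ext; intros; apply zsum_ext; auto. Qed.

Lemma cell_sum_ext M1 M2 f g :
  (forall a b, f a b = g a b) -> cell_sum M1 M2 f = cell_sum M1 M2 g.
Proof. intros H. apply cell_sum_ext_in; auto. Qed.

Lemma cell_sum_le_in M1 M2 f g :
  (forall a b, (0 <= a < Z.of_nat M1)%Z -> (0 <= b < Z.of_nat M2)%Z -> f a b <= g a b) ->
  cell_sum M1 M2 f <= cell_sum M1 M2 g.
Proof. intros H. apply zsum_le; intros; apply zsum_le; auto. Qed.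

Lemma cell_sum_le M1 M2 f g :
  (forall a b, f a b <= g a b) -> cell_sum M1 M2 f <= cell_sum M1 M2 g.
Proof. intros H. apply cell_sum_le_in; auto. Qed.

Lemma cell_sum_plus M1 M2 f g :
  cell_sum M1 M2 (fun a b => f a b + g a b) = cell_sum M1 M2 f + cell_sum M1 M2 g.
Proof.
  unfold cell_sum. rewrite <- zsum_plus. apply zsum_ext; intros. apply zsum_plus.
Qed.

Lemma cell_sum_scal M1 M2 c f :
  cell_sum M1 M2 (fun a b => c * f a b) = c * cell_sum M1 M2 f.
Proof.
  unfold cell_sum. rewrite <- zsum_scal. apply zsum_ext; intros. apply zsum_scal.
Qed.

Lemma cell_sum_const M1 M2 c : cell_sum M1 M2 (fun _ _ => c) = INR M1 * INR M2 * c.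
Proof.
  unfold cell_sum. rewrite (zsum_ext _ _ (fun _ => INR M2 * c)).
  - rewrite zsum_const; ring.
  - intros; apply zsum_const.
Qed.

Lemma cell_sum_nonneg M1 M2 f : (forall a b, 0 <= f a b) -> 0 <= cell_sum M1 M2 f.
Proof.
  intros H. replace 0 with (cell_sum M1 M2 (fun _ _ => 0)) by (rewrite cell_sum_const; ring).
  apply cell_sum_le; auto.
Qed.

(** [true] is the [x] direction and [false] the [y] direction. *)
Definition fwd (d : bool) (f : gridfun) : gridfun :=
  fun a b => if d then f (a + 1)%Z b else f a (b + 1)%Z.
Definition bwd (d : bool) (f : gridfun) : gridfun :=
  fun a b => if d then f (a - 1)%Z b else f a (b - 1)%Z.

Lemma fwd_bwd d f a b : fwd d (bwd d f) a b = f a b.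
Proof. destruct d; unfold fwd, bwd; rewrite Z.add_simpl_r; reflexivity. Qed.

Lemma periodic_fwd M1 M2 d f : periodic M1 M2 f -> periodic M1 M2 (fwd d f).
Proof.
  intros H a b; destruct d; unfold fwd; split;
    rewrite ?(Z.add_shuffle0 _ (Z.of_nat _) 1); apply H.
Qed.

Lemma periodic_bwd M1 M2 d f : periodic M1 M2 f -> periodic M1 M2 (bwd d f).
Proof.
  intros H a b; destruct d; unfold bwd; split; try apply H; unfold Z.sub;
    rewrite (Z.add_shuffle0 _ (Z.of_nat _) (- (1))); apply H.
Qed.

Lemma periodic_map2 (op : R -> R -> R) M1 M2 f g :
  periodic M1 M2 f -> periodic M1 M2 g -> periodic M1 M2 (fun a b => op (f a b) (g a b)).
Proof.
  intros Hf Hg a b. destruct (Hf a b) as [H1 H2], (Hg a b) as [H3 H4].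
  now rewrite H1, H2, H3, H4.
Qed.

Lemma periodic_map (op : R -> R) M1 M2 f :
  periodic M1 M2 f -> periodic M1 M2 (fun a b => op (f a b)).
Proof. intros H. exact (periodic_map2 (fun x _ => op x) M1 M2 f f H H). Qed.

Lemma cell_sum_fwd M1 M2 d f :
  periodic M1 M2 f -> cell_sum M1 M2 (fwd d f) = cell_sum M1 M2 f.
Proof.
  intros H. unfold cell_sum, fwd. destruct d.
  - apply (zsum_shift M1 (fun a => zsum M2 (fun b => f a b))).
    intros a. apply zsum_ext; intros b _. apply H.
  - apply zsum_ext; intros a _. apply (zsum_shift M2 (fun b => f a b)).
    intros b. apply H.
Qed.

Lemma cell_sum_bwd M1 M2 d f :
  periodic M1 M2 f -> cell_sum M1 M2 (bwd d f) = cell_sum M1 M2 f.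
Proof.
  intros H. rewrite <- (cell_sum_fwd M1 M2 d (bwd d f)) by now apply periodic_bwd.
  apply cell_sum_ext; intros. apply fwd_bwd.
Qed.

(** Summation by parts in pointwise form: [F] is the flux through one face, [G] the flux through the
    opposite one, and their difference sums to zero over a period. Each later summation by parts
    then amounts to naming a flux and checking an inequality between nodal values. *)
Lemma cell_sum_le_telescope M1 M2 d F G X Y :
  periodic M1 M2 F -> (forall a b, bwd d F a b = G a b) ->
  (forall a b, X a b <= Y a b + (F a b - G a b)) ->
  cell_sum M1 M2 X <= cell_sum M1 M2 Y.
Proof.
  intros HF HG H. apply Rle_trans with
    (cell_sum M1 M2 (fun a b => Y a b + (F a b + (-1) * bwd d F a b))).
  - apply cell_sum_le. intros a b. specialize (H a b). rewrite HG. lra.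
  - rewrite !cell_sum_plus, cell_sum_scal, cell_sum_bwd by assumption. lra.
Qed.

Lemma cell_sum_eq_telescope M1 M2 d F G X Y :
  periodic M1 M2 F -> (forall a b, bwd d F a b = G a b) ->
  (forall a b, X a b = Y a b + (F a b - G a b)) ->
  cell_sum M1 M2 X = cell_sum M1 M2 Y.
Proof.
  intros HF HG H. rewrite (cell_sum_ext _ _ _ (fun a b => Y a b + (F a b + (-1) * bwd d F a b))).
  - rewrite !cell_sum_plus, cell_sum_scal, cell_sum_bwd by assumption. ring.
  - intros a b. rewrite H, HG. ring.
Qed.

Lemma periodic_mult M1 M2 (f : gridfun) (i j a b : Z) :
  periodic M1 M2 f -> f (a + i * Z.of_nat M1)%Z (b + j * Z.of_nat M2)%Z = f a b.
Proof.
  intros H.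
  assert (Hx : forall n a b, f (a + Z.of_nat n * Z.of_nat M1)%Z b = f a b).
  { induction n as [|n IH]; intros a' b'; [now rewrite Z.add_0_r|].
    rewrite <- (IH a' b'). rewrite <- (proj1 (H (a' + Z.of_nat n * Z.of_nat M1)%Z b')).
    f_equal; lia. }
  assert (Hy : forall n a b, f a (b + Z.of_nat n * Z.of_nat M2)%Z = f a b).
  { induction n as [|n IH]; intros a' b'; [now rewrite Z.add_0_r|].
    rewrite <- (IH a' b'). rewrite <- (proj2 (H a' (b' + Z.of_nat n * Z.of_nat M2)%Z)).
    f_equal; lia. }
  transitivity (f a (b + j * Z.of_nat M2)%Z).
  - destruct (Z.le_ge_cases 0 i).
    + rewrite <- (Z2Nat.id i) by lia. apply Hx.
    + rewrite <- (Hx (Z.to_nat (- i))). rewrite Z2Nat.id by lia. f_equal; lia.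
  - destruct (Z.le_ge_cases 0 j).
    + rewrite <- (Z2Nat.id j) by lia. apply Hy.
    + rewrite <- (Hy (Z.to_nat (- j))). rewrite Z2Nat.id by lia. f_equal; lia.
Qed.

Lemma in_Omega_repr M1 M2 a b : (1 <= M1)%nat -> (1 <= M2)%nat ->
  exists a' b' i j, in_Omega M1 M2 a' b' /\
    a = (a' + i * Z.of_nat M1)%Z /\ b = (b' + j * Z.of_nat M2)%Z.
Proof.
  intros H1 H2.
  exists ((a - 1) mod Z.of_nat M1 + 1)%Z, ((b - 1) mod Z.of_nat M2 + 1)%Z,
    ((a - 1) / Z.of_nat M1)%Z, ((b - 1) / Z.of_nat M2)%Z.
  pose proof (Z.mod_pos_bound (a - 1) (Z.of_nat M1) ltac:(lia)).
  pose proof (Z.mod_pos_bound (b - 1) (Z.of_nat M2) ltac:(lia)).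
  pose proof (Z.div_mod (a - 1) (Z.of_nat M1) ltac:(lia)).
  pose proof (Z.div_mod (b - 1) (Z.of_nat M2) ltac:(lia)).
  unfold in_Omega. lia.
Qed.

(** The schemes are imposed at the nodes of [in_Omega] only, whereas the shifts used in summation by
    parts need them at all integer indices; periodicity bridges the two. *)
Lemma periodic_le_Omega M1 M2 f g : (1 <= M1)%nat -> (1 <= M2)%nat ->
  periodic M1 M2 f -> periodic M1 M2 g ->
  (forall a b, in_Omega M1 M2 a b -> f a b <= g a b) ->
  forall a b, f a b <= g a b.
Proof.
  intros H1 H2 Hf Hg H a b.
  destruct (in_Omega_repr M1 M2 a b H1 H2) as (a' & b' & i & j & Ho & -> & ->).
  rewrite !periodic_mult by assumption. auto.
Qed.

Lemma periodic_eq_Omega M1 M2 f g : (1 <= M1)%nat -> (1 <= M2)%nat ->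
  periodic M1 M2 f -> periodic M1 M2 g ->
  (forall a b, in_Omega M1 M2 a b -> f a b = g a b) ->
  forall a b, f a b = g a b.
Proof.
  intros H1 H2 Hf Hg H a b.
  apply Rle_antisym; apply (periodic_le_Omega M1 M2); auto; intros; rewrite H; auto; lra.
Qed.

(** The norm sums over indices from 1 to [M], [cell_sum] over 0 to [M - 1]; for a periodic function
    the shift by one node changes nothing. *)
Lemma norm_h_cell_sum h M1 M2 (v : gridfun) : periodic M1 M2 v ->
  norm_h h M1 M2 v = sqrt (h ^ 2 * cell_sum M1 M2 (fun a b => v a b ^ 2)).
Proof.
  intros H. unfold norm_h. do 2 f_equal.
  rewrite (sum_n_m_ext _ (fun a => zsum M2 (fun b => v (Z.of_nat a) b ^ 2))).
  - rewrite (sum_n_m_zsum M1 (fun a => zsum M2 (fun b => v a b ^ 2))).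
    apply (zsum_shift M1 (fun a => zsum M2 (fun b => v a b ^ 2))).
    intros a. apply zsum_ext; intros b _. now rewrite (proj1 (H a b)).
  - intros a. rewrite (sum_n_m_zsum M2 (fun b => v (Z.of_nat a) b ^ 2)).
    apply (zsum_shift M2 (fun b => v (Z.of_nat a) b ^ 2)).
    intros b. now rewrite (proj2 (H (Z.of_nat a) b)).
Qed.

(** For expressions in the values and single shifts of periodic functions: all periodicity equations
    at the node are collected and then used as rewrite rules. *)
Ltac periodicity :=
  let a := fresh "a" in let b := fresh "b" in
  intros a b;
  repeat match goal with
    | H : periodic _ _ ?f |- _ =>
        pose proof (H a b);
        pose proof (periodic_fwd _ _ true _ H a b);
        pose proof (periodic_fwd _ _ false _ H a b);
        pose proof (periodic_bwd _ _ true _ H a b);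
        pose proof (periodic_bwd _ _ false _ H a b);
        try match goal with d : bool |- _ =>
          pose proof (periodic_fwd _ _ d _ H a b);
          pose proof (periodic_bwd _ _ d _ H a b) end;
        clear H
    end;
  repeat match goal with E : _ /\ _ |- _ => destruct E end;
  split; cbv beta;
  repeat match goal with
    | E : ?l = ?r :> R |- context [?l] => rewrite E
    end; try reflexivity.

Ltac shifted :=
  match goal with d : bool |- _ =>
    intros; destruct d; unfold bwd, fwd; rewrite ?Z.sub_add; reflexivity end.

(** * Discrete energy identities *)

Definition hat (d : bool) (h : R) : gridfun -> gridfun :=
  if d then hat_x h else hat_y h.
Definition lap (d : bool) (h : R) : gridfun -> gridfun :=
  if d then delta_xx h else delta_yy h.
(** The one-sided difference is chosen because its square sum, not that of the centred [hat], is
    what [lap] dissipates. *)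
Definition grad (d : bool) (h : R) (v : gridfun) : gridfun :=
  fun a b => (fwd d v a b - v a b) / h.

Lemma hatE d h v a b : hat d h v a b = (fwd d v a b - bwd d v a b) / (2 * h).
Proof. now destruct d. Qed.

Lemma lapE d h v a b : lap d h v a b = (fwd d v a b - 2 * v a b + bwd d v a b) / h ^ 2.
Proof. now destruct d. Qed.

Lemma fwd2 (op : R -> R -> R) d f g a b :
  fwd d (fun i j => op (f i j) (g i j)) a b = op (fwd d f a b) (fwd d g a b).
Proof. now destruct d. Qed.

Lemma bwd2 (op : R -> R -> R) d f g a b :
  bwd d (fun i j => op (f i j) (g i j)) a b = op (bwd d f a b) (bwd d g a b).
Proof. now destruct d. Qed.

Lemma psiE d h u v a b :
  psi (hat d h) u v a b =
  / 3 * (u a b * ((fwd d v a b - bwd d v a b) / (2 * h))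
         + (fwd d u a b * fwd d v a b - bwd d u a b * bwd d v a b) / (2 * h)).
Proof. now destruct d. Qed.

Section Energy.
Variables (M1 M2 : nat) (h : R).
Hypothesis h_pos : 0 < h.

Notation S := (cell_sum M1 M2).

(** Neither half of [psi] telescopes alone. The flux pairs one term of the advective half, [u v v+],
    with one of the conservative half, [u+ v+ v]; the equal weights of the two halves make its
    backward shift cancel the remaining terms. *)
Lemma psi_skew d u v : periodic M1 M2 u -> periodic M1 M2 v ->
  S (fun a b => psi (hat d h) u v a b * v a b) = 0.
Proof.
  intros Hu Hv. transitivity (S (fun _ _ => 0)); [|rewrite cell_sum_const; ring].
  apply (cell_sum_eq_telescope _ _ d (fun a b =>
    / (6 * h) * (u a b * v a b * fwd d v a b + fwd d u a b * fwd d v a b * v a b))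
    (fun a b => / (6 * h) * (bwd d u a b * bwd d v a b * v a b + u a b * v a b * bwd d v a b))).
  - periodicity.
  - shifted.
  - intros a b. rewrite psiE. field; lra.
Qed.

Lemma lap_by_parts d f g : periodic M1 M2 f -> periodic M1 M2 g ->
  S (fun a b => f a b * lap d h g a b) = - S (fun a b => grad d h f a b * grad d h g a b).
Proof.
  intros Hf Hg.
  replace (- S _) with (S (fun a b => (-1) * (grad d h f a b * grad d h g a b)))
    by (rewrite cell_sum_scal; ring).
  apply (cell_sum_eq_telescope _ _ d (fun a b =>
    fwd d f a b * (fwd d g a b - g a b) / h ^ 2)
    (fun a b => f a b * (g a b - bwd d g a b) / h ^ 2)).
  - periodicity.
  - shifted.
  - intros a b. rewrite lapE. unfold grad. field; lra.
Qed.

(** Inverse inequality: [(v+ - v)^2 <= 2 (v+)^2 + 2 v^2] at each node, and both squares have the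
    same sum over a period. *)
Lemma sum_grad_sq_le d v : periodic M1 M2 v ->
  S (fun a b => grad d h v a b ^ 2) <= 4 / h ^ 2 * S (fun a b => v a b ^ 2).
Proof.
  intros Hv. rewrite <- cell_sum_scal.
  apply (cell_sum_le_telescope _ _ d (fun a b => 2 / h ^ 2 * fwd d v a b ^ 2)
    (fun a b => 2 / h ^ 2 * v a b ^ 2)).
  - periodicity.
  - shifted.
  - intros a b. unfold grad.
    replace (((fwd d v a b - v a b) / h) ^ 2) with (/ h ^ 2 * (fwd d v a b - v a b) ^ 2)
      by (field; lra).
    assert (0 < / h ^ 2) by (apply Rinv_0_lt_compat; nra).
    pose proof (Rmult_le_pos (/ h ^ 2) _ ltac:(lra) (pow2_ge_0 (fwd d v a b + v a b))).
    unfold Rdiv. nra.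
Qed.

Lemma sum_lin2 c f k g :
  S (fun a b => c * f a b + k * g a b) = c * S f + k * S g.
Proof. now rewrite cell_sum_plus, !cell_sum_scal. Qed.

(** The averaging operator [1 + h^2/12 lap] has spectrum in [[2/3, 1]], so that
   inverting it only strengthens the dissipation of [lap]. *)
Lemma compact_dissipation d u v q :
  periodic M1 M2 u -> periodic M1 M2 v ->
  (forall a b, v a b = lap d h u a b - h ^ 2 / 12 * lap d h v a b + q a b) ->
  S (fun a b => v a b * u a b) <=
    - S (fun a b => grad d h u a b ^ 2) + h ^ 2 / 32 * S (fun a b => q a b ^ 2)
    + S (fun a b => q a b * u a b).
Proof.
  intros Hu Hv E.
  (* [E1] is the compact relation tested with [u], [E2] the relation tested with [v]. After
     summation by parts both contain the mixed product of [grad u] and [grad v], and [E2] expresses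
     it through [v], [grad v] and [q]. *)
  assert (E1 : S (fun a b => v a b * u a b) =
    S (fun a b => u a b * lap d h u a b) - h ^ 2 / 12 * S (fun a b => u a b * lap d h v a b)
    + S (fun a b => q a b * u a b)).
  { rewrite (cell_sum_ext _ _ _ (fun a b => 1 * (1 * (u a b * lap d h u a b)
      + (- (h ^ 2 / 12)) * (u a b * lap d h v a b)) + 1 * (q a b * u a b))).
    - rewrite !sum_lin2. ring.
    - intros a b. rewrite E at 1. ring. }
  assert (E2 : S (fun a b => v a b * lap d h u a b) =
    S (fun a b => v a b ^ 2) + h ^ 2 / 12 * S (fun a b => v a b * lap d h v a b)
    - S (fun a b => v a b * q a b)).
  { rewrite (cell_sum_ext _ _ _ (fun a b => 1 * (1 * (v a b ^ 2)
      + (h ^ 2 / 12) * (v a b * lap d h v a b)) + (-1) * (v a b * q a b))).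
    - rewrite !sum_lin2. ring.
    - intros a b. pose proof (E a b) as Eab.
      replace (lap d h u a b) with (v a b + h ^ 2 / 12 * lap d h v a b - q a b) by lra. ring. }
  rewrite !lap_by_parts in E1, E2 by assumption.
  assert (E3 : S (fun a b => grad d h u a b * grad d h v a b) =
               S (fun a b => grad d h v a b * grad d h u a b))
    by (apply cell_sum_ext; intros; ring).
  assert (E4 : forall f, S (fun a b => grad d h f a b * grad d h f a b)
                         = S (fun a b => grad d h f a b ^ 2))
    by (intros; apply cell_sum_ext; intros; ring).
  rewrite !E4 in E1, E2.
  pose proof (sum_grad_sq_le d v Hv) as G.
  (* With the inverse inequality [G], the terms in [v] alone amount to at most
     [- h^2/12 + h^2/36 = - h^2/18] times the sum of [v^2]. Against [h^2/12 v q] the maximum is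
     reached at [v = 3 q / 4] and equals [h^2/32 q^2]. *)
  assert (Y : S (fun a b => h ^ 2 / 12 * (v a b * q a b) + (- (h ^ 2 / 18)) * v a b ^ 2)
              <= S (fun a b => h ^ 2 / 32 * q a b ^ 2)).
  { apply cell_sum_le. intros a b.
    pose proof (Rmult_le_pos (h ^ 2 / 2) ((v a b / 3 - q a b / 4) ^ 2)
      ltac:(nra) ltac:(apply pow2_ge_0)). nra. }
  rewrite sum_lin2, cell_sum_scal in Y.
  assert (G' : h ^ 2 * h ^ 2 * S (fun a b => grad d h v a b ^ 2) <=
               4 * h ^ 2 * S (fun a b => v a b ^ 2)).
  { apply Rmult_le_compat_l with (r := h ^ 2 * h ^ 2) in G; [|nra].
    eapply Rle_trans; [exact G|]. apply Req_le. field. lra. }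
  assert (F : h ^ 2 * S (fun a b => grad d h v a b * grad d h u a b) =
     - h ^ 2 * S (fun a b => v a b ^ 2)
     + h ^ 2 * h ^ 2 / 12 * S (fun a b => grad d h v a b ^ 2)
     + h ^ 2 * S (fun a b => v a b * q a b)).
  { assert (S (fun a b => grad d h v a b * grad d h u a b) = - S (fun a b => v a b ^ 2)
      + h ^ 2 / 12 * S (fun a b => grad d h v a b ^ 2) + S (fun a b => v a b * q a b)) as -> by lra.
    field. }
  rewrite E1, E3. lra.
Qed.

(** This makes [h ^ 2] times the error of a second derivative as harmless as the error of the
    function itself. In the relation tested with [h ^ 4 * v], the inverse inequality consumes a
    third of [h ^ 4 * v ^ 2] and Young's inequality a sixth for each of [h ^ 2 * lap u] and
    [h ^ 2 * q]. The remaining third gives the constants 72 and 9/2, rounded up to 100. *)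
Lemma compact_bound d u v q :
  periodic M1 M2 u -> periodic M1 M2 v ->
  (forall a b, v a b = lap d h u a b - h ^ 2 / 12 * lap d h v a b + q a b) ->
  h ^ 4 * S (fun a b => v a b ^ 2) <=
    100 * (S (fun a b => u a b ^ 2) + h ^ 4 * S (fun a b => q a b ^ 2)).
Proof.
  intros Hu Hv E.
  pose proof (sum_grad_sq_le d v Hv) as G.
  assert (E4 : S (fun a b => v a b * lap d h v a b) = - S (fun a b => grad d h v a b ^ 2)).
  { rewrite lap_by_parts by assumption. f_equal. apply cell_sum_ext; intros; ring. }
  assert (P : h ^ 4 * S (fun a b => v a b ^ 2)
      + h ^ 6 / 12 * S (fun a b => v a b * lap d h v a b) <=
      h ^ 4 / 3 * S (fun a b => v a b ^ 2) + 24 * S (fun a b => u a b ^ 2)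
        + 3 / 2 * (h ^ 4 * S (fun a b => q a b ^ 2))).
  { rewrite <- sum_lin2.
    replace (_ + 3 / 2 * _) with (S (fun a b => 1 * (h ^ 4 / 3 * v a b ^ 2 + 24 * u a b ^ 2) +
       3 / 2 * h ^ 4 * q a b ^ 2)) by (rewrite !sum_lin2; ring).
    (* The square of the second difference is bounded by a combination of [u+^2], [u^2] and [u-^2]
       with coefficients 6, 12 and 6; this flux moves all of it to the centre, as [24 u^2]. *)
    apply (cell_sum_le_telescope _ _ d
      (fun a b => 6 * fwd d u a b ^ 2 - 6 * u a b ^ 2)
      (fun a b => 6 * u a b ^ 2 - 6 * bwd d u a b ^ 2)).
    - periodicity.
    - shifted.
    - intros a b. pose proof (E a b) as Eab.
      assert (Z : h ^ 4 * v a b ^ 2 + h ^ 6 / 12 * (v a b * lap d h v a b) =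
        (h ^ 2 * v a b) * (h ^ 2 * lap d h u a b) + (h ^ 2 * v a b) * (h ^ 2 * q a b)).
      { replace (lap d h u a b) with (v a b + h ^ 2 / 12 * lap d h v a b - q a b) by lra.
        field. }
      rewrite Z. clear Z.
      replace (h ^ 2 * lap d h u a b) with (fwd d u a b - 2 * u a b + bwd d u a b)
        by (rewrite lapE; field; lra).
      replace (h ^ 4 / 3 * v a b ^ 2) with ((h ^ 2 * v a b) ^ 2 / 3) by field.
      replace (3 / 2 * h ^ 4 * q a b ^ 2) with (3 / 2 * (h ^ 2 * q a b) ^ 2) by field.
      generalize (h ^ 2 * v a b) (h ^ 2 * q a b) (u a b) (fwd d u a b) (bwd d u a b).
      intros x y u0 up um.
      assert (x * y <= x ^ 2 / 6 + 3 / 2 * y ^ 2) by (pose proof (pow2_ge_0 (x - 3 * y)); nra).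
      assert (x * (up - 2 * u0 + um) <= x ^ 2 / 6 + 3 / 2 * (up - 2 * u0 + um) ^ 2)
        by (pose proof (pow2_ge_0 (x - 3 * (up - 2 * u0 + um))); nra).
      assert ((up - 2 * u0 + um) ^ 2 <= 4 * (up ^ 2 + 2 * u0 ^ 2 + um ^ 2)).
      { pose proof (pow2_ge_0 (up + u0)). pose proof (pow2_ge_0 (um + u0)).
        pose proof (pow2_ge_0 (up - um)). nra. }
      lra. }
  rewrite E4 in P.
  assert (G' : h ^ 6 / 12 * S (fun a b => grad d h v a b ^ 2) <=
               h ^ 4 / 3 * S (fun a b => v a b ^ 2)).
  { apply Rmult_le_compat_l with (r := h ^ 6 / 12) in G.
    - eapply Rle_trans; [exact G|]. apply Req_le. field. lra.
    - assert (0 < h ^ 6) by now apply pow_lt. lra. }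
  assert (0 <= S (fun a b => u a b ^ 2)) by (apply cell_sum_nonneg; intros; apply pow2_ge_0).
  assert (0 <= h ^ 4 * S (fun a b => q a b ^ 2)).
  { apply Rmult_le_pos; [apply pow_le; lra|].
    apply cell_sum_nonneg; intros; apply pow2_ge_0. }
  lra.
Qed.

(** Summation by parts moves the difference from [eps * U] to [e], where it is
   absorbed by the dissipation. *)
Lemma psi_perturbation B eta d eps U e : 0 <= B -> 0 < eta ->
  periodic M1 M2 eps -> periodic M1 M2 U -> periodic M1 M2 e ->
  (forall a b, Rabs (U a b) <= B) -> (forall a b, Rabs (hat d h U a b) <= B) ->
  S (fun a b => psi (hat d h) eps U a b * e a b) <=
    eta * S (fun a b => grad d h e a b ^ 2)
    + (B + B ^ 2 / eta) * (S (fun a b => eps a b ^ 2) + S (fun a b => e a b ^ 2)).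
Proof.
  intros HB He Peps PU Pe BU BdU.
  replace (_ + _ * (_ + _)) with (S (fun a b => 1 * (eta * grad d h e a b ^ 2 +
     (B + B ^ 2 / eta) * eps a b ^ 2) + (B + B ^ 2 / eta) * e a b ^ 2))
    by (rewrite !sum_lin2; ring).
  (* The first part of the flux carries the summation by parts. The second trades half of the
     forward difference of [e] for the backward one: the centred difference of [e] is the mean of
     [Gp] and [Gm], so the dissipation has to be available in both. *)
  apply (cell_sum_le_telescope _ _ d
    (fun a b => (eps a b * U a b * fwd d e a b + fwd d eps a b * fwd d U a b * e a b)
                / (6 * h) - eta / 2 * grad d h e a b ^ 2)
    (fun a b => (bwd d eps a b * bwd d U a b * e a b + eps a b * U a b * bwd d e a b)
                / (6 * h) - eta / 2 * ((e a b - bwd d e a b) / h) ^ 2)).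
  - unfold grad. periodicity.
  - unfold grad. shifted.
  - intros a b. rewrite psiE. specialize (BU a b). specialize (BdU a b).
    rewrite hatE in BdU.
    set (D := (fwd d U a b - bwd d U a b) / (2 * h)) in *.
    set (Gp := grad d h e a b). set (Gm := (e a b - bwd d e a b) / h).
    assert (X : / 3 * (eps a b * D + (fwd d eps a b * fwd d U a b - bwd d eps a b * bwd d U a b)
        / (2 * h)) * e a b
      = (eps a b * (D * e a b) - eps a b * (U a b * ((Gp + Gm) / 2))) / 3
        + ((eps a b * U a b * fwd d e a b + fwd d eps a b * fwd d U a b * e a b) / (6 * h)
          - (bwd d eps a b * bwd d U a b * e a b + eps a b * U a b * bwd d e a b) / (6 * h)))
      by (unfold Gp, Gm, grad; field; lra).
    rewrite X. clear X.
    assert (X1 : eps a b * (D * e a b) <= B * (eps a b ^ 2 + e a b ^ 2)).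
    { assert ((D * e a b) ^ 2 <= B ^ 2 * e a b ^ 2).
      { rewrite Rpow_mult_distr. apply Rmult_le_compat_r; [apply pow2_ge_0|].
        rewrite <- (pow2_abs D). apply pow_incr. split; [apply Rabs_pos|assumption]. }
      apply Rle_trans with (Rabs (eps a b * (D * e a b))); [apply Rle_abs|].
      rewrite !Rabs_mult.
      assert (Rabs D * Rabs (e a b) <= B * Rabs (e a b))
        by (apply Rmult_le_compat_r; [apply Rabs_pos|assumption]).
      rewrite <- (pow2_abs (eps a b)), <- (pow2_abs (e a b)).
      pose proof (Rabs_pos (eps a b)). pose proof (Rabs_pos (e a b)).
      generalize dependent (Rabs (eps a b)). generalize dependent (Rabs (e a b)). intros.
      apply Rle_trans with (r0 * (B * r)); [apply Rmult_le_compat_l; lra|].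
      pose proof (pow2_ge_0 (r - r0)).
      pose proof (Rmult_le_pos B _ HB (pow2_ge_0 (r - r0))).
      pose proof (Rmult_le_pos B _ HB (pow2_ge_0 r)).
      pose proof (Rmult_le_pos B _ HB (pow2_ge_0 r0)). nra. }
    assert (X2 : - (eps a b * (U a b * ((Gp + Gm) / 2))) <=
      B ^ 2 / eta * eps a b ^ 2 + eta / 2 * (Gp ^ 2 + Gm ^ 2)).
    { assert (Y1 : U a b ^ 2 <= B ^ 2).
      { rewrite <- (pow2_abs (U a b)). apply pow_incr. split; [apply Rabs_pos|assumption]. }
      assert (Y2 : U a b ^ 2 / eta * eps a b ^ 2 <= B ^ 2 / eta * eps a b ^ 2).
      { apply Rmult_le_compat_r; [apply pow2_ge_0|]. apply Rmult_le_compat_r; [|assumption].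
        left; now apply Rinv_0_lt_compat. }
      eapply Rle_trans; [|apply Rplus_le_compat_r; exact Y2].
      assert (0 <= / eta) by (left; now apply Rinv_0_lt_compat).
      pose proof (Rmult_le_pos _ _ (Rlt_le _ _ He) (pow2_ge_0 (Gp - Gm))).
      pose proof (Rmult_le_pos _ _ (Rlt_le _ _ He) (pow2_ge_0 (Gp + Gm))).
      assert (/ eta * (U a b * eps a b + eta * ((Gp + Gm) / 4)) ^ 2 >= 0).
      { apply Rle_ge, Rmult_le_pos; [assumption|apply pow2_ge_0]. }
      assert (/ eta * (U a b * eps a b + eta * ((Gp + Gm) / 4)) ^ 2
        = U a b ^ 2 / eta * eps a b ^ 2 + 2 * (U a b * eps a b * ((Gp + Gm) / 4))
          + eta * ((Gp + Gm) / 4) ^ 2) by (field; lra).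
      nra. }
    pose proof (pow2_ge_0 (eps a b)). pose proof (pow2_ge_0 (e a b)).
    assert (0 <= B ^ 2 / eta)
      by (apply Rmult_le_pos; [apply pow2_ge_0|left; now apply Rinv_0_lt_compat]).
    assert (0 <= eta * (Gp ^ 2 + Gm ^ 2))
      by (apply Rmult_le_pos; [lra|pose proof (pow2_ge_0 Gp); pose proof (pow2_ge_0 Gm); lra]).
    assert (0 <= B ^ 2 / eta * e a b ^ 2) by (now apply Rmult_le_pos).
    assert (0 <= B ^ 2 / eta * eps a b ^ 2) by (now apply Rmult_le_pos).
    assert (0 <= B * e a b ^ 2) by (now apply Rmult_le_pos).
    assert (0 <= B * eps a b ^ 2) by (now apply Rmult_le_pos).
    lra.
Qed.

End Energy.

(** * Energy inequality at one time level *)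

Lemma psi_hE h u v a b :
  psi_h h u v a b = psi (hat true h) u v a b + psi (hat false h) u v a b.
Proof. unfold psi_h, psi, hat_h, hat. ring. Qed.

Lemma psi_scal d h c u v a b :
  psi (hat d h) (fun i j => c * u i j) v a b = c * psi (hat d h) u v a b.
Proof.
  rewrite !psiE, (fwd2 (fun x _ => c * x) d u u), (bwd2 (fun x _ => c * x) d u u).
  unfold Rdiv; ring.
Qed.

Lemma cell_sum_sq_nonneg M1 M2 (f : gridfun) : 0 <= cell_sum M1 M2 (fun a b => f a b ^ 2).
Proof. apply cell_sum_nonneg; intros; apply pow2_ge_0. Qed.

Lemma cell_sum_young M1 M2 (f g : gridfun) :
  cell_sum M1 M2 (fun a b => f a b * g a b) <=
  / 2 * (cell_sum M1 M2 (fun a b => f a b ^ 2) + cell_sum M1 M2 (fun a b => g a b ^ 2)).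
Proof.
  rewrite <- cell_sum_plus, <- cell_sum_scal. apply cell_sum_le. intros a b.
  pose proof (pow2_ge_0 (f a b - g a b)). nra.
Qed.

Section EnergyStep.
Variables (M1 M2 : nat) (h lambda : R).
Hypotheses (h_pos : 0 < h) (lambda_pos : 0 < lambda).

Notation S := (cell_sum M1 M2).
Notation per := (periodic M1 M2).

(** The factor [c] is absorbed into [eps], so that it appears squared. It will be -1 for the
    advecting error and [h ^ 2 / 2] for the error of the second derivative; the square of the
    latter, [h ^ 4 / 4], is the weight that [compact_bound] can handle. Each use spends half of the
    dissipation [lambda], and each direction has two uses. *)
Lemma psi_perturbation_scal B c d eps U e : 0 <= B ->
  per eps -> per U -> per e ->
  (forall a b, Rabs (U a b) <= B) -> (forall a b, Rabs (hat d h U a b) <= B) ->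
  c * S (fun a b => psi (hat d h) eps U a b * e a b) <=
    lambda / 2 * S (fun a b => grad d h e a b ^ 2)
    + (B + 2 * B ^ 2 / lambda)
      * (c ^ 2 * S (fun a b => eps a b ^ 2) + S (fun a b => e a b ^ 2)).
Proof.
  intros HB Pe PU Pee BU BdU.
  pose proof (psi_perturbation M1 M2 h h_pos B (lambda / 2) d (fun a b => c * eps a b) U e
    HB ltac:(lra) (periodic_map _ _ _ _ Pe) PU Pee BU BdU) as X.
  rewrite (cell_sum_ext _ _ (fun a b => (c * eps a b) ^ 2) (fun a b => c ^ 2 * eps a b ^ 2)) in X
    by (intros; ring).
  rewrite (cell_sum_ext _ _ (fun a b => psi _ _ _ a b * _)
    (fun a b => c * (psi (hat d h) eps U a b * e a b))) in X
    by (intros; rewrite psi_scal; ring).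
  rewrite !cell_sum_scal in X.
  replace (B ^ 2 / (lambda / 2)) with (2 * B ^ 2 / lambda) in X by (field; lra).
  exact X.
Qed.

(** The two perturbation terms together use up the dissipation supplied by [compact_dissipation], so
    no [grad e] survives on the right. The 26 is 1 from the advecting error plus 100/4 from
    [compact_bound] with weight [h ^ 4 / 4]. *)
Lemma error_energy_dir B H d U e eps g gam adv q :
  0 <= B -> h <= H ->
  per U -> per e -> per eps -> per g -> per gam -> per adv ->
  (forall a b, Rabs (U a b) <= B) -> (forall a b, Rabs (hat d h U a b) <= B) ->
  (forall a b, g a b = lap d h e a b - h ^ 2 / 12 * lap d h g a b + q a b) ->
  (forall a b, gam a b = lap d h eps a b - h ^ 2 / 12 * lap d h gam a b + q a b) ->
  S (fun a b => (lambda * g a b - psi (hat d h) eps U a b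
        + h ^ 2 / 2 * (psi (hat d h) adv e a b + psi (hat d h) gam U a b)) * e a b) <=
    (26 * (B + 2 * B ^ 2 / lambda) * (1 + H ^ 4) + lambda * (1 + H ^ 2)) *
    (S (fun a b => eps a b ^ 2) + S (fun a b => e a b ^ 2) + S (fun a b => q a b ^ 2)).
Proof.
  intros HB HH PU Pe Peps Pg Pgam Padv BU BdU Eg Egam.
  set (K0 := B + 2 * B ^ 2 / lambda).
  rewrite (cell_sum_ext _ _ _ (fun a b => 1 * (lambda * (g a b * e a b)
    + (-1) * (psi (hat d h) eps U a b * e a b)) + h ^ 2 / 2 *
    (1 * (psi (hat d h) adv e a b * e a b) + 1 * (psi (hat d h) gam U a b * e a b))))
    by (intros; ring).
  rewrite !sum_lin2, psi_skew by assumption.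
  pose proof (compact_dissipation M1 M2 h h_pos d e g q Pe Pg Eg) as X1.
  pose proof (compact_bound M1 M2 h h_pos d eps gam q Peps Pgam Egam) as X2.
  pose proof (psi_perturbation_scal B (-1) d eps U e HB Peps PU Pe BU BdU) as X3.
  pose proof (psi_perturbation_scal B (h ^ 2 / 2) d gam U e HB Pgam PU Pe BU BdU) as X4.
  fold K0 in X3, X4.
  pose proof (cell_sum_young M1 M2 q e) as X5.
  pose proof (cell_sum_sq_nonneg M1 M2 eps) as N1.
  pose proof (cell_sum_sq_nonneg M1 M2 e) as N2.
  pose proof (cell_sum_sq_nonneg M1 M2 q) as N3.
  assert (HK : 0 <= K0).
  { unfold K0. assert (0 <= 2 * B ^ 2 / lambda); [|lra].
    apply Rmult_le_pos; [pose proof (pow2_ge_0 B); lra|left; now apply Rinv_0_lt_compat]. }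
  assert (h ^ 2 <= H ^ 2) by (apply pow_incr; lra).
  assert (h ^ 4 <= H ^ 4) by (apply pow_incr; lra).
  assert (0 <= h ^ 2) by apply pow2_ge_0.
  assert (0 <= h ^ 4) by (apply pow_le; lra).
  replace ((h ^ 2 / 2) ^ 2) with (h ^ 4 / 4) in X4 by field.
  set (s1 := S (fun a b => eps a b ^ 2)) in *.
  set (s2 := S (fun a b => e a b ^ 2)) in *.
  set (s3 := S (fun a b => q a b ^ 2)) in *.
  assert (Y1 : h ^ 4 * s3 <= H ^ 4 * s3) by (now apply Rmult_le_compat_r).
  assert (Y2 : h ^ 2 * s3 <= H ^ 2 * s3) by (now apply Rmult_le_compat_r).
  assert (Y3 : K0 * (h ^ 4 / 4 * S (fun a b => gam a b ^ 2) + s2)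
               <= K0 * (25 * s1 + 25 * (H ^ 4 * s3) + s2))
    by (apply Rmult_le_compat_l; lra).
  apply Rmult_le_compat_l with (r := lambda) in X1; [|lra].
  apply Rmult_le_compat_l with (r := lambda) in X5; [|lra].
  apply Rmult_le_compat_l with (r := lambda) in Y2; [|lra].
  assert (0 <= K0 * s1) by (now apply Rmult_le_pos).
  assert (0 <= K0 * s2) by (now apply Rmult_le_pos).
  assert (0 <= K0 * s3) by (now apply Rmult_le_pos).
  assert (0 <= lambda * s1) by (apply Rmult_le_pos; lra).
  assert (0 <= lambda * s2) by (apply Rmult_le_pos; lra).
  assert (0 <= lambda * s3) by (apply Rmult_le_pos; lra).
  assert (0 <= H ^ 4) by lra. assert (0 <= H ^ 2) by lra.
  assert (0 <= H ^ 4 * (K0 * s1)) by (now apply Rmult_le_pos).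
  assert (0 <= H ^ 4 * (K0 * s2)) by (now apply Rmult_le_pos).
  assert (0 <= H ^ 4 * (K0 * s3)) by (now apply Rmult_le_pos).
  assert (0 <= H ^ 2 * (lambda * s1)) by (now apply Rmult_le_pos).
  assert (0 <= H ^ 2 * (lambda * s2)) by (now apply Rmult_le_pos).
  assert (0 <= H ^ 2 * (lambda * s3)) by (now apply Rmult_le_pos).
  lra.
Qed.

(** [dt] is an arbitrary grid function, which keeps the estimate purely spatial; the time difference
    of the error is inserted later. The added 1 in the constant pays for the momentum defect [P]
    tested with [e]. *)
Lemma error_energy B H U e eps g1 g2 gam1 gam2 A b1 b2 P q1 q2 dt :
  0 <= B -> h <= H ->
  per U -> per e -> per eps -> per g1 -> per g2 -> per gam1 -> per gam2 ->
  per A -> per b1 -> per b2 ->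
  (forall a b, Rabs (U a b) <= B) -> (forall d a b, Rabs (hat d h U a b) <= B) ->
  (forall a b, g1 a b = delta_xx h e a b - h ^ 2 / 12 * delta_xx h g1 a b + q1 a b) ->
  (forall a b, g2 a b = delta_yy h e a b - h ^ 2 / 12 * delta_yy h g2 a b + q2 a b) ->
  (forall a b, gam1 a b = delta_xx h eps a b - h ^ 2 / 12 * delta_xx h gam1 a b + q1 a b) ->
  (forall a b, gam2 a b = delta_yy h eps a b - h ^ 2 / 12 * delta_yy h gam2 a b + q2 a b) ->
  (forall a b, dt a b + (psi_h h A e a b + psi_h h eps U a b)
     - h ^ 2 / 2 * (psi_x h b1 e a b + psi_x h gam1 U a b
                    + (psi_y h b2 e a b + psi_y h gam2 U a b))
     - lambda * (g1 a b + g2 a b) = P a b) ->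
  S (fun a b => dt a b * e a b) <=
    (1 + 2 * (26 * (B + 2 * B ^ 2 / lambda) * (1 + H ^ 4) + lambda * (1 + H ^ 2))) *
    (S (fun a b => eps a b ^ 2) + S (fun a b => e a b ^ 2) + S (fun a b => P a b ^ 2)
     + S (fun a b => q1 a b ^ 2) + S (fun a b => q2 a b ^ 2)).
Proof.
  intros HB HH PU Pe Peps Pg1 Pg2 Pm1 Pm2 PA Pb1 Pb2 BU BdU E1 E2 E3 E4 EM.
  pose proof (error_energy_dir B H true U e eps g1 gam1 b1 q1 HB HH PU Pe Peps Pg1 Pm1 Pb1
    BU (BdU true) E1 E3) as X1.
  pose proof (error_energy_dir B H false U e eps g2 gam2 b2 q2 HB HH PU Pe Peps Pg2 Pm2 Pb2
    BU (BdU false) E2 E4) as X2.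
  rewrite (cell_sum_ext _ _ (fun a b => dt a b * e a b) (fun a b =>
   1 * (1 * ((lambda * g1 a b - psi (hat true h) eps U a b
        + h ^ 2 / 2 * (psi (hat true h) b1 e a b + psi (hat true h) gam1 U a b)) * e a b)
    + 1 * ((lambda * g2 a b - psi (hat false h) eps U a b
        + h ^ 2 / 2 * (psi (hat false h) b2 e a b + psi (hat false h) gam2 U a b)) * e a b))
    + 1 * (1 * (P a b * e a b) + (-1) * (1 * (psi (hat true h) A e a b * e a b)
             + 1 * (psi (hat false h) A e a b * e a b))))).
  2: { intros a b. specialize (EM a b). rewrite !psi_hE in EM.
       change (psi_x h) with (psi (hat true h)) in EM.
       change (psi_y h) with (psi (hat false h)) in EM. rewrite <- EM. ring. }
  rewrite !sum_lin2, !psi_skew by assumption.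
  pose proof (cell_sum_young M1 M2 P e) as X5.
  pose proof (cell_sum_sq_nonneg M1 M2 eps) as N1.
  pose proof (cell_sum_sq_nonneg M1 M2 e) as N2.
  pose proof (cell_sum_sq_nonneg M1 M2 q1) as N3.
  pose proof (cell_sum_sq_nonneg M1 M2 q2) as N4.
  pose proof (cell_sum_sq_nonneg M1 M2 P) as N5.
  set (K := 26 * _ * _ + _) in *.
  assert (HK : 0 <= K).
  { unfold K. assert (0 <= 2 * B ^ 2 / lambda).
    { apply Rmult_le_pos; [pose proof (pow2_ge_0 B); lra|left; now apply Rinv_0_lt_compat]. }
    assert (0 <= H ^ 4) by (apply pow_le; lra). assert (0 <= H ^ 2) by (apply pow_le; lra).
    apply Rplus_le_le_0_compat; apply Rmult_le_pos; lra. }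
  set (s1 := S (fun a b => eps a b ^ 2)) in *.
  set (s2 := S (fun a b => e a b ^ 2)) in *.
  set (s3 := S (fun a b => q1 a b ^ 2)) in *.
  set (s4 := S (fun a b => q2 a b ^ 2)) in *.
  set (s5 := S (fun a b => P a b ^ 2)) in *.
  assert (0 <= K * s3) by (now apply Rmult_le_pos).
  assert (0 <= K * s4) by (now apply Rmult_le_pos).
  assert (0 <= K * s5) by (now apply Rmult_le_pos).
  lra.
Qed.

(** The same test applied to the solution itself: with zero defect the diffusion terms are
    nonpositive and all [psi] terms vanish by skewness. *)
Lemma solution_energy u v w A b1 b2 dt :
  per u -> per v -> per w -> per A -> per b1 -> per b2 ->
  (forall a b, v a b = delta_xx h u a b - h ^ 2 / 12 * delta_xx h v a b) ->
  (forall a b, w a b = delta_yy h u a b - h ^ 2 / 12 * delta_yy h w a b) ->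
  (forall a b, dt a b + psi_h h A u a b
     - h ^ 2 / 2 * (psi_x h b1 u a b + psi_y h b2 u a b)
     - lambda * (v a b + w a b) = 0) ->
  S (fun a b => dt a b * u a b) <= 0.
Proof.
  intros Pu Pv Pw PA Pb1 Pb2 E1 E2 EM.
  pose proof (compact_dissipation M1 M2 h h_pos true u v (fun _ _ => 0) Pu Pv
    ltac:(intros; rewrite E1 at 1; unfold lap; ring)) as X1.
  pose proof (compact_dissipation M1 M2 h h_pos false u w (fun _ _ => 0) Pu Pw
    ltac:(intros; rewrite E2 at 1; unfold lap; ring)) as X2.
  cbv beta in X1, X2.
  assert (Z1 : S (fun _ _ => 0 ^ 2) = 0) by (rewrite cell_sum_const; ring).
  assert (Z2 : S (fun a b => 0 * u a b) = 0) by (rewrite cell_sum_scal; ring).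
  rewrite Z1, Z2 in X1. rewrite Z1, Z2 in X2.
  pose proof (cell_sum_sq_nonneg M1 M2 (grad true h u)).
  pose proof (cell_sum_sq_nonneg M1 M2 (grad false h u)).
  rewrite (cell_sum_ext _ _ (fun a b => dt a b * u a b) (fun a b =>
   1 * (lambda * (v a b * u a b) + lambda * (w a b * u a b))
    + 1 * ((-1) * (1 * (psi (hat true h) A u a b * u a b)
             + 1 * (psi (hat false h) A u a b * u a b))
      + h ^ 2 / 2 * (1 * (psi (hat true h) b1 u a b * u a b)
             + 1 * (psi (hat false h) b2 u a b * u a b))))).
  2: { intros a b. specialize (EM a b). rewrite !psi_hE in EM.
       change (psi_x h) with (psi (hat true h)) in EM.
       change (psi_y h) with (psi (hat false h)) in EM.
       replace (dt a b) with (lambda * (v a b + w a b) + h ^ 2 / 2 *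
         (psi (hat true h) b1 u a b + psi (hat false h) b2 u a b)
         - (psi (hat true h) A u a b + psi (hat false h) A u a b)) by lra. ring. }
  rewrite !sum_lin2, !psi_skew by assumption.
  assert (S (fun a b => v a b * u a b) <= 0) by lra.
  assert (S (fun a b => w a b * u a b) <= 0) by lra.
  nra.
Qed.

End EnergyStep.

(** * One time step of the schemes: stability and error recursion *)

Lemma periodic_ext M1 M2 f g :
  (forall a b, f a b = g a b) -> periodic M1 M2 g -> periodic M1 M2 f.
Proof. intros E H a b. rewrite !E. apply H. Qed.

Lemma periodic_psi M1 M2 d h u v :
  periodic M1 M2 u -> periodic M1 M2 v -> periodic M1 M2 (psi (hat d h) u v).
Proof.
  intros Hu Hv. eapply periodic_ext; [intros; apply psiE|]. periodicity.
Qed.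

Lemma periodic_lap M1 M2 d h v : periodic M1 M2 v -> periodic M1 M2 (lap d h v).
Proof. intros Hv. eapply periodic_ext; [intros; apply lapE|]. periodicity. Qed.

Lemma periodic_mid M1 M2 N v n : in_V M1 M2 N v -> (n <= N)%nat -> periodic M1 M2 (mid v n).
Proof.
  intros H Hn. assert (H1 := H n Hn). assert (H2 := H (n - 1)%nat ltac:(lia)).
  intros a b. unfold mid. destruct (H1 a b) as [-> ->], (H2 a b) as [-> ->]. auto.
Qed.

Lemma periodic_momentum lambda h tau M1 M2 N U V W u v w n :
  in_V M1 M2 N U -> in_V M1 M2 N V -> in_V M1 M2 N W ->
  in_V M1 M2 N u -> in_V M1 M2 N v -> in_V M1 M2 N w -> (n <= N)%nat ->
  periodic M1 M2 (momentum lambda h tau U V W u v w n).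
Proof.
  intros HU HV HW Hu Hv Hw Hn.
  pose proof (Hu n Hn) as P1. pose proof (Hu (n - 1)%nat ltac:(lia)) as P2.
  pose proof (periodic_mid _ _ _ _ _ HU Hn) as PU.
  pose proof (periodic_mid _ _ _ _ _ HV Hn) as PV.
  pose proof (periodic_mid _ _ _ _ _ HW Hn) as PW.
  pose proof (periodic_mid _ _ _ _ _ Hu Hn) as Pu.
  pose proof (periodic_mid _ _ _ _ _ Hv Hn) as Pv.
  pose proof (periodic_mid _ _ _ _ _ Hw Hn) as Pw.
  pose proof (periodic_psi _ _ true h _ _ PU Pu) as Q1.
  pose proof (periodic_psi _ _ false h _ _ PU Pu) as Q2.
  pose proof (periodic_psi _ _ true h _ _ PV Pu) as Q3.
  pose proof (periodic_psi _ _ false h _ _ PW Pu) as Q4.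
  intros a b. unfold momentum, delta_t. rewrite !psi_hE.
  change (psi_x h) with (psi (hat true h)). change (psi_y h) with (psi (hat false h)).
  destruct (P1 a b) as [-> ->], (P2 a b) as [-> ->], (Pv a b) as [-> ->], (Pw a b) as [-> ->],
    (Q1 a b) as [-> ->], (Q2 a b) as [-> ->], (Q3 a b) as [-> ->], (Q4 a b) as [-> ->]. auto.
Qed.

Section SchemeStep.
Variables (lambda h tau : R) (M1 M2 N : nat).
Hypotheses (lambda_pos : 0 < lambda) (h_pos : 0 < h) (tau_pos : 0 < tau)
  (M1_pos : (1 <= M1)%nat) (M2_pos : (1 <= M2)%nat).

Notation S := (cell_sum M1 M2).

Lemma scheme_momentum u0 A BB CC u v w :
  in_V M1 M2 N A -> in_V M1 M2 N BB -> in_V M1 M2 N CC ->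
  scheme_solution lambda h tau M1 M2 N u0 A BB CC u v w ->
  forall n a b, (1 <= n <= N)%nat -> momentum lambda h tau A BB CC u v w n a b = 0.
Proof.
  intros HA HB HC (Hu & Hv & Hw & Hm & _) n a b Hn.
  apply (periodic_eq_Omega M1 M2 _ (fun _ _ => 0)); auto.
  - apply (periodic_momentum lambda h tau M1 M2 N); auto; lia.
  - intros ? ?; auto.
Qed.

Lemma compact_everywhere u v w :
  in_V M1 M2 N u -> in_V M1 M2 N v -> in_V M1 M2 N w ->
  compact_relations h M1 M2 N u v w ->
  forall n a b, (n <= N)%nat ->
    v n a b = compact_x h (u n) (v n) a b /\ w n a b = compact_y h (u n) (w n) a b.
Proof.
  intros Hu Hv Hw HR n a b Hn. split.
  - apply (periodic_eq_Omega M1 M2); auto.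
    + apply (periodic_map2 (fun x y => x - h ^ 2 / 12 * y) M1 M2 (delta_xx h (u n)) (delta_xx h (v n)));
        apply (periodic_lap _ _ true); auto.
    + intros; now apply HR.
  - apply (periodic_eq_Omega M1 M2); auto.
    + apply (periodic_map2 (fun x y => x - h ^ 2 / 12 * y) M1 M2 (delta_yy h (u n)) (delta_yy h (w n)));
        apply (periodic_lap _ _ false); auto.
    + intros; now apply HR.
Qed.

(** Testing with the midpoint value makes the time difference exact, by
    [(x - y) (x + y) = x^2 - y^2]; the time discretisation neither creates nor destroys energy. *)
Lemma energy_difference u n :
  S (fun a b => u n a b ^ 2) - S (fun a b => u (n - 1)%nat a b ^ 2)
  = 2 * tau * S (fun a b => delta_t tau u n a b * mid u n a b).
Proof.
  rewrite <- cell_sum_scal.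
  replace (S (fun a b => u n a b ^ 2) - _)
    with (1 * S (fun a b => u n a b ^ 2) + (-1) * S (fun a b => u (n - 1)%nat a b ^ 2)) by ring.
  rewrite <- sum_lin2. apply cell_sum_ext; intros. unfold delta_t, mid. field. lra.
Qed.

Lemma scheme_stability u0 A BB CC u v w :
  in_V M1 M2 N A -> in_V M1 M2 N BB -> in_V M1 M2 N CC ->
  scheme_solution lambda h tau M1 M2 N u0 A BB CC u v w ->
  forall n, (n <= N)%nat ->
  S (fun a b => u n a b ^ 2) <= S (fun a b => u 0%nat a b ^ 2).
Proof.
  intros HA HB HC Hsol. induction n as [|n IH]; intros Hn; [lra|].
  eapply Rle_trans; [|apply IH; lia].
  pose proof (energy_difference u (Datatypes.S n)) as E.
  replace (Datatypes.S n - 1)%nat with n in E by lia.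
  pose proof (scheme_momentum _ _ _ _ _ _ _ HA HB HC Hsol (Datatypes.S n)) as HM.
  destruct Hsol as (Hu & Hv & Hw & _ & HR & _).
  pose proof (compact_everywhere _ _ _ Hu Hv Hw HR) as HC'.
  enough (S (fun a b => delta_t tau u (Datatypes.S n) a b * mid u (Datatypes.S n) a b) <= 0) by nra.
  apply (solution_energy M1 M2 h lambda h_pos lambda_pos _ (mid v (Datatypes.S n))
    (mid w (Datatypes.S n)) (mid A (Datatypes.S n)) (mid BB (Datatypes.S n)) (mid CC (Datatypes.S n)));
    try (eapply periodic_mid; eassumption).
  - intros a b. unfold mid at 1. pose proof (proj1 (HC' (Datatypes.S n) a b Hn)) as X1.
    pose proof (proj1 (HC' (Datatypes.S n - 1)%nat a b ltac:(lia))) as X2.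
    rewrite X1, X2. unfold compact_x, delta_xx, mid. field. lra.
  - intros a b. unfold mid at 1. pose proof (proj2 (HC' (Datatypes.S n) a b Hn)) as X1.
    pose proof (proj2 (HC' (Datatypes.S n - 1)%nat a b ltac:(lia))) as X2.
    rewrite X1, X2. unfold compact_y, delta_yy, mid. field. lra.
  - intros a b. exact (HM a b ltac:(lia)).
Qed.

Lemma cell_sum_le_const (f : gridfun) c : 0 <= c ->
  (forall a b, Rabs (f a b) <= c) ->
  S (fun a b => f a b ^ 2) <= INR M1 * INR M2 * c ^ 2.
Proof.
  intros Hc Hf. rewrite <- cell_sum_const. apply cell_sum_le. intros a b.
  rewrite <- (pow2_abs (f a b)). apply pow_incr. split; [apply Rabs_pos|auto].
Qed.

Lemma mid_sq_le (u : nat -> gridfun) n :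
  S (fun a b => mid u n a b ^ 2) <=
  / 2 * (S (fun a b => u n a b ^ 2) + S (fun a b => u (n - 1)%nat a b ^ 2)).
Proof.
  rewrite <- cell_sum_plus, <- cell_sum_scal. apply cell_sum_le. intros a b. unfold mid.
  pose proof (pow2_ge_0 (u n a b - u (n - 1)%nat a b)). nra.
Qed.

(** The advecting error is left unestimated because its bound differs between the two grids. The
    midpoint mean of [e] is split into its two levels, the form required by the Gronwall argument,
    and the factor 3 counts the momentum defect and the two compact defects. *)
Lemma scheme_error_step B H C rho u0 U V W A BB CC u v w :
  0 <= B -> h <= H -> 0 <= C -> 0 <= rho ->
  in_V M1 M2 N U -> in_V M1 M2 N V -> in_V M1 M2 N W ->
  in_V M1 M2 N A -> in_V M1 M2 N BB -> in_V M1 M2 N CC ->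
  compact_relations h M1 M2 N A BB CC ->
  scheme_solution lambda h tau M1 M2 N u0 A BB CC u v w ->
  (forall n a b, (n <= N)%nat -> Rabs (U n a b) <= B) ->
  (forall n d a b, (n <= N)%nat -> Rabs (hat d h (U n) a b) <= B) ->
  (forall n a b, (1 <= n <= N)%nat ->
     Rabs (momentum lambda h tau U V W U V W n a b) <= C * rho) ->
  (forall n a b, (n <= N)%nat ->
     Rabs (V n a b - compact_x h (U n) (V n) a b) <= C * rho /\
     Rabs (W n a b - compact_y h (U n) (W n) a b) <= C * rho) ->
  forall n, (1 <= n <= N)%nat ->
  let e := fun n a b => U n a b - u n a b in
  S (fun a b => e n a b ^ 2) - S (fun a b => e (n - 1)%nat a b ^ 2) <=
  2 * tau * (1 + 2 * (26 * (B + 2 * B ^ 2 / lambda) * (1 + H ^ 4) + lambda * (1 + H ^ 2))) *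
   (S (fun a b => mid (fun n a b => U n a b - A n a b) n a b ^ 2)
    + / 2 * (S (fun a b => e n a b ^ 2) + S (fun a b => e (n - 1)%nat a b ^ 2))
    + 3 * (INR M1 * INR M2 * (C * rho) ^ 2)).
Proof.
  intros HB HH HC Hrho HU HV HW HA HBB HCC HRA Hsol BU BdU HP HQ n Hn e.
  pose proof (scheme_momentum _ _ _ _ _ _ _ HA HBB HCC Hsol n) as HM.
  destruct Hsol as (Hu & Hv & Hw & _ & HR & _).
  pose proof (compact_everywhere _ _ _ Hu Hv Hw HR) as Hc.
  pose proof (compact_everywhere _ _ _ HA HBB HCC HRA) as HcA.
  clear HR HRA.
  assert (Hsub : forall X Y, in_V M1 M2 N X -> in_V M1 M2 N Y ->
     periodic M1 M2 (mid (fun n a b => X n a b - Y n a b) n)).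
  { intros X Y HX HY. apply (periodic_mid M1 M2 N); [|lia]. intros k Hk.
    apply (periodic_map2 Rminus); auto. }
  assert (Hmid : forall X, in_V M1 M2 N X -> periodic M1 M2 (mid X n))
    by (intros; apply (periodic_mid M1 M2 N); auto; lia).
  rewrite (energy_difference e n). rewrite !Rmult_assoc.
  apply Rmult_le_compat_l; [lra|]. apply Rmult_le_compat_l; [lra|]. rewrite <- !Rmult_assoc.
  set (Q1 := fun n a b => V n a b - compact_x h (U n) (V n) a b).
  set (Q2 := fun n a b => W n a b - compact_y h (U n) (W n) a b).
  assert (Hn1 : (n <= N)%nat) by lia. assert (Hn2 : (n - 1 <= N)%nat) by lia.
  eapply Rle_trans;
    [apply (error_energy M1 M2 h lambda h_pos lambda_pos B H (mid U n) (mid e n)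
      (mid (fun n a b => U n a b - A n a b) n) (mid (fun n a b => V n a b - v n a b) n)
      (mid (fun n a b => W n a b - w n a b) n) (mid (fun n a b => V n a b - BB n a b) n)
      (mid (fun n a b => W n a b - CC n a b) n) (mid A n) (mid BB n) (mid CC n)
      (momentum lambda h tau U V W U V W n) (mid Q1 n) (mid Q2 n)); auto|].
  - apply Hsub; auto.
  - intros a b. unfold mid.
    pose proof (BU n a b Hn1) as X1. pose proof (BU (n - 1)%nat a b Hn2) as X2.
    apply Rabs_le_between in X1, X2. apply Rabs_le_between. lra.
  - intros d a b. pose proof (BdU n d a b Hn1) as X1.
    pose proof (BdU (n - 1)%nat d a b Hn2) as X2.
    assert (hat d h (mid U n) a b = (hat d h (U n) a b + hat d h (U (n - 1)%nat) a b) / 2) as ->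
      by (rewrite !hatE; unfold mid; destruct d; unfold fwd, bwd; field; lra).
    apply Rabs_le_between in X1, X2. apply Rabs_le_between. lra.
  - intros a b. unfold mid at 1.
    rewrite (proj1 (Hc n a b Hn1)), (proj1 (Hc (n - 1)%nat a b Hn2)).
    unfold Q1, e, compact_x, delta_xx, mid. field. lra.
  - intros a b. unfold mid at 1.
    rewrite (proj2 (Hc n a b Hn1)), (proj2 (Hc (n - 1)%nat a b Hn2)).
    unfold Q2, e, compact_y, delta_yy, mid. field. lra.
  - intros a b. unfold mid at 1.
    rewrite (proj1 (HcA n a b Hn1)), (proj1 (HcA (n - 1)%nat a b Hn2)).
    unfold Q1, compact_x, delta_xx, mid. field. lra.
  - intros a b. unfold mid at 1.
    rewrite (proj2 (HcA n a b Hn1)), (proj2 (HcA (n - 1)%nat a b Hn2)).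
    unfold Q2, compact_y, delta_yy, mid. field. lra.
  (* The residual of the scheme is zero, so it may be subtracted from that of the exact solution;
     the difference is then the linearised equation by an identity between nodal values. *)
  - intros a b. specialize (HM a b Hn).
    replace (momentum lambda h tau U V W U V W n a b) with
      (momentum lambda h tau U V W U V W n a b - momentum lambda h tau A BB CC u v w n a b)
      by (rewrite HM; ring). clear HM.
    unfold momentum, e, delta_t, psi_x, psi_y, psi_h, psi, hat_h, hat_x, hat_y, mid.
    field. lra.
  - apply Rmult_le_compat_l.
    { assert (0 <= 2 * B ^ 2 / lambda).
      { apply Rmult_le_pos; [pose proof (pow2_ge_0 B); lra|left; now apply Rinv_0_lt_compat]. }
      assert (0 <= H ^ 4) by (apply pow_le; lra). assert (0 <= H ^ 2) by (apply pow_le; lra).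
      assert (0 <= 26 * (B + 2 * B ^ 2 / lambda) * (1 + H ^ 4)) by (apply Rmult_le_pos; lra).
      assert (0 <= lambda * (1 + H ^ 2)) by (apply Rmult_le_pos; lra). lra. }
    assert (HCr : 0 <= C * rho) by (apply Rmult_le_pos; assumption).
    pose proof (mid_sq_le e n).
    pose proof (cell_sum_le_const _ _ HCr (fun a b => HP n a b Hn)).
    assert (Hmq : forall (Q : nat -> gridfun), (forall n a b, (n <= N)%nat -> Rabs (Q n a b) <= C * rho) ->
       S (fun a b => mid Q n a b ^ 2) <= INR M1 * INR M2 * (C * rho) ^ 2).
    { intros Q BQ. apply cell_sum_le_const; auto. intros a b. unfold mid.
      pose proof (BQ n a b Hn1) as X1. pose proof (BQ (n - 1)%nat a b Hn2) as X2.
      apply Rabs_le_between in X1, X2. apply Rabs_le_between. lra. }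
    pose proof (Hmq Q1 (fun n a b Hk => proj1 (HQ n a b Hk))).
    pose proof (Hmq Q2 (fun n a b Hk => proj2 (HQ n a b Hk))).
    lra.
Qed.

End SchemeStep.

(** * Gronwall's inequality and convergence of one scheme *)

(** The quantity [E n + s] grows per step by at most [(1 + x) / (1 - x)], and [x <= 1/2] is exactly
    what bounds this by [1 + 4 x], hence by [exp (4 x)]. *)
Lemma discrete_gronwall (E : nat -> R) (x s : R) (N : nat) :
  0 <= x <= / 2 -> 0 <= s -> E 0%nat <= 0 ->
  (forall n, (n <= N)%nat -> 0 <= E n) ->
  (forall n, (1 <= n <= N)%nat -> E n - E (n - 1)%nat <= x * (E n + E (n - 1)%nat + s)) ->
  forall n, (n <= N)%nat -> E n <= exp (4 * x * INR n) * s.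
Proof.
  intros Hx Hs H0 Hpos Hstep.
  assert (X : forall n, (n <= N)%nat -> E n + s <= exp (4 * x * INR n) * s).
  { induction n as [|n IH]; intros Hn.
    - simpl INR. rewrite Rmult_0_r, exp_0. lra.
    - specialize (IH ltac:(lia)). specialize (Hstep (S n) ltac:(lia)).
      replace (S n - 1)%nat with n in Hstep by lia.
      pose proof (Hpos n ltac:(lia)) as Hp.
      apply Rle_trans with ((1 + 4 * x) * (E n + s)).
      + assert (A : (1 - x) * E (S n) <= (1 - x) * ((1 + 4 * x) * E n + 2 * x * s)).
        { assert (0 <= x * (1 - 2 * x)) by (apply Rmult_le_pos; lra).
          pose proof (Rmult_le_pos _ _ H Hp). pose proof (Rmult_le_pos _ _ H Hs). nra. }
        apply Rmult_le_reg_l in A; [|lra].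
        assert (0 <= x * s) by (apply Rmult_le_pos; lra). lra.
      + rewrite S_INR.
        replace (4 * x * (INR n + 1)) with (4 * x * INR n + 4 * x) by ring.
        rewrite exp_plus, (Rmult_comm (exp (4 * x * INR n))), Rmult_assoc.
        apply Rmult_le_compat; [lra| |apply exp_ineq1_le|exact IH].
        lra. }
  intros n Hn. specialize (X n Hn). lra.
Qed.

(** For steps too large for Gronwall's inequality, the unconditional stability of
   the scheme already gives an error of order [1 <= C tau^4]. *)
Lemma scheme_convergence lambda B H C D T area :
  0 < lambda -> 0 <= B -> 0 <= C -> 0 <= D -> 0 <= area ->
  exists K, 0 < K /\
  forall (h tau : R) (M1 M2 N : nat) u0 U V W A BB CC u v w (rho : R),
  0 < h -> h <= H -> 0 < tau -> (1 <= M1)%nat -> (1 <= M2)%nat ->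
  INR N * tau = T -> h ^ 2 * (INR M1 * INR M2) = area -> tau ^ 2 <= rho ->
  in_V M1 M2 N U -> in_V M1 M2 N V -> in_V M1 M2 N W ->
  in_V M1 M2 N A -> in_V M1 M2 N BB -> in_V M1 M2 N CC ->
  compact_relations h M1 M2 N A BB CC ->
  scheme_solution lambda h tau M1 M2 N u0 A BB CC u v w ->
  (forall a b, U 0%nat a b = u0 (IZR a * h) (IZR b * h)) ->
  (forall n a b, (n <= N)%nat -> Rabs (U n a b) <= B) ->
  (forall n d a b, (n <= N)%nat -> Rabs (hat d h (U n) a b) <= B) ->
  (forall n a b, (1 <= n <= N)%nat ->
     Rabs (momentum lambda h tau U V W U V W n a b) <= C * rho) ->
  (forall n a b, (n <= N)%nat ->
     Rabs (V n a b - compact_x h (U n) (V n) a b) <= C * rho /\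
     Rabs (W n a b - compact_y h (U n) (W n) a b) <= C * rho) ->
  let E := fun n => h ^ 2 * cell_sum M1 M2 (fun a b => (U n a b - u n a b) ^ 2) in
  (forall n, (1 <= n <= N)%nat ->
     h ^ 2 * cell_sum M1 M2 (fun a b => mid (fun n a b => U n a b - A n a b) n a b ^ 2)
     <= D * (E n + E (n - 1)%nat + rho ^ 2)) ->
  forall n, (n <= N)%nat -> E n <= K * rho ^ 2.
Proof.
  intros Hl HB HC HD Har.
  set (K1 := 1 + 2 * (26 * (B + 2 * B ^ 2 / lambda) * (1 + H ^ 4) + lambda * (1 + H ^ 2))).
  (* [tau * G] will be the Gronwall parameter: [D] comes from the advecting error, 1 covers the mean
     of the two error levels, and [3 * area * C ^ 2] the three defects. *)
  set (G := 2 * K1 * (D + 1 + 3 * area * C ^ 2)).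
  assert (HK1 : 0 < K1).
  { unfold K1. assert (0 <= 2 * B ^ 2 / lambda).
    { apply Rmult_le_pos; [pose proof (pow2_ge_0 B); lra|left; now apply Rinv_0_lt_compat]. }
    assert (0 <= H ^ 4) by (replace (H ^ 4) with ((H ^ 2) ^ 2) by ring; apply pow2_ge_0).
    assert (0 <= H ^ 2) by apply pow2_ge_0.
    assert (0 <= 26 * (B + 2 * B ^ 2 / lambda) * (1 + H ^ 4)) by (apply Rmult_le_pos; lra).
    assert (0 <= lambda * (1 + H ^ 2)) by (apply Rmult_le_pos; lra). lra. }
  assert (HaC : 0 <= 3 * area * C ^ 2) by (apply Rmult_le_pos; [lra|apply pow2_ge_0]).
  assert (HG : 0 < G) by (unfold G; apply Rmult_lt_0_compat; lra).
  (* The first summand is for [tau * G <= 1/2]. The second is for larger [tau]: stability gives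
     [E n <= 4 * area * B ^ 2], and [(2 * G) ^ 4 * rho ^ 2 >= (2 * G * tau) ^ 4 >= 1]. *)
  exists (exp (4 * G * T) + 4 * area * B ^ 2 * (2 * G) ^ 4). split.
  { pose proof (exp_pos (4 * G * T)).
    assert (0 <= 4 * area * B ^ 2) by (apply Rmult_le_pos; [lra|apply pow2_ge_0]).
    assert (0 <= (2 * G) ^ 4) by (apply pow_le; lra). nra. }
  intros h tau M1 M2 N u0 U V W A BB CC u v w rho Hh HH Ht HM1 HM2 HT Harea Hrho
    HU HV HW HA HBB HCC HRA Hsol Hinit BU BdU HP HQ E Hadv n Hn.
  assert (Hr0 : 0 <= rho) by (pose proof (pow2_ge_0 tau); lra).
  assert (Hr2 : 0 <= rho ^ 2) by apply pow2_ge_0.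
  assert (HE : forall k, 0 <= E k).
  { intros k. apply Rmult_le_pos; [apply pow2_ge_0|apply cell_sum_sq_nonneg]. }
  assert (Hin : forall a b, U 0%nat a b = u 0%nat a b).
  { apply (periodic_eq_Omega M1 M2); auto.
    - apply HU; lia.
    - apply Hsol; lia.
    - intros a b Ho. rewrite Hinit. symmetry. now apply Hsol. }
  assert (HaB : 0 <= 4 * area * B ^ 2) by (apply Rmult_le_pos; [lra|apply pow2_ge_0]).
  destruct (Rle_lt_dec (tau * G) (/ 2)) as [Hsmall|Hbig].
  - apply Rle_trans with (exp (4 * (tau * G) * INR n) * rho ^ 2).
    + apply (discrete_gronwall E (tau * G) (rho ^ 2) N); auto.
      * split; [apply Rmult_le_pos; lra|assumption].
      * unfold E. rewrite (cell_sum_ext _ _ _ (fun _ _ => 0)).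
        { rewrite cell_sum_const. lra. }
        intros; rewrite Hin; ring.
      * intros k Hk.
        pose proof (scheme_error_step lambda h tau M1 M2 N Hl Hh Ht HM1 HM2 B H C rho u0
          U V W A BB CC u v w HB HH HC Hr0 HU HV HW HA HBB HCC HRA Hsol BU BdU HP HQ k Hk) as X.
        cbv beta zeta in X. fold K1 in X.
        specialize (Hadv k Hk).
        apply Rmult_le_compat_l with (r := h ^ 2) in X; [|apply pow2_ge_0].
        set (s0 := cell_sum M1 M2 (fun a b => mid _ k a b ^ 2)) in *.
        set (p := E k) in *. set (p' := E (k - 1)%nat) in *.
        assert (X' : p - p' <= 2 * tau * K1 *
          (h ^ 2 * s0 + / 2 * (p + p') + 3 * (area * (C * rho) ^ 2))).
        { unfold p, p', E. rewrite <- Harea.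
          eapply Rle_trans; [|eapply Rle_trans; [exact X|]]; apply Req_le; ring. }
        eapply Rle_trans; [exact X'|].
        replace (tau * G * (p + p' + rho ^ 2)) with
          (2 * tau * K1 * ((D + 1 + 3 * area * C ^ 2) * (p + p' + rho ^ 2)))
          by (unfold G; ring).
        apply Rmult_le_compat_l.
        { apply Rmult_le_pos; lra. }
        pose proof (HE k) as Hp. pose proof (HE (k - 1)%nat) as Hp'. fold p in Hp. fold p' in Hp'.
        rewrite Rpow_mult_distr.
        pose proof (Rmult_le_pos _ _ HaC Hp). pose proof (Rmult_le_pos _ _ HaC Hp').
        lra.
    + apply Rmult_le_compat_r; auto.
      apply Rle_trans with (exp (4 * G * T)).
      * destruct (Rle_lt_or_eq_dec (INR n) (INR N)) as [Hlt|Heq]; [now apply le_INR| |].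
        -- left. apply exp_increasing. rewrite <- HT.
           assert (0 < tau * G) by (now apply Rmult_lt_0_compat). nra.
        -- right. f_equal. rewrite <- HT, Heq. ring.
      * assert (0 <= (2 * G) ^ 4) by (apply pow_le; lra).
        pose proof (Rmult_le_pos _ _ HaB H0). lra.
  - assert (X1 : E n <= 4 * area * B ^ 2).
    { pose proof (scheme_stability lambda h tau M1 M2 N Hl Hh Ht HM1 HM2 u0 A BB CC u v w
        HA HBB HCC Hsol n Hn) as St.
      rewrite (cell_sum_ext _ _ (fun a b => u 0%nat a b ^ 2) (fun a b => U 0%nat a b ^ 2)) in St
        by (intros; rewrite Hin; ring).
      pose proof (cell_sum_le_const M1 M2 (U 0%nat) B HB (fun a b => BU 0%nat a b ltac:(lia))).
      pose proof (cell_sum_le_const M1 M2 (U n) B HB (fun a b => BU n a b Hn)).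
      assert (X : cell_sum M1 M2 (fun a b => (U n a b - u n a b) ^ 2) <=
         2 * cell_sum M1 M2 (fun a b => U n a b ^ 2)
         + 2 * cell_sum M1 M2 (fun a b => u n a b ^ 2)).
      { rewrite <- sum_lin2. apply cell_sum_le; intros a b.
        pose proof (pow2_ge_0 (U n a b + u n a b)). nra. }
      unfold E. rewrite <- Harea.
      replace (4 * (h ^ 2 * (INR M1 * INR M2)) * B ^ 2)
        with (h ^ 2 * (4 * (INR M1 * INR M2 * B ^ 2))) by ring.
      apply Rmult_le_compat_l; [apply pow2_ge_0|]. lra. }
    assert (X2 : 1 <= (2 * G) ^ 4 * rho ^ 2).
    { apply Rle_trans with ((2 * G) ^ 4 * tau ^ 4).
      - replace ((2 * G) ^ 4 * tau ^ 4) with ((2 * (tau * G)) ^ 4) by ring.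
        rewrite <- (pow1 4). apply pow_incr. lra.
      - apply Rmult_le_compat_l; [apply pow_le; lra|].
        replace (tau ^ 4) with ((tau ^ 2) ^ 2) by ring.
        apply pow_incr. split; [apply pow2_ge_0|assumption]. }
    pose proof (exp_pos (4 * G * T)).
    pose proof (Rmult_le_compat_l _ _ _ HaB X2). nra.
Qed.

(** * Bounds and interpolation errors for smooth functions *)

(** Compactness of the box leaves finitely many centres around which [f] varies by less than 1, and
    the bound is the largest [Rabs f + 1] among them. [compactness_list] concludes under a double
    negation and takes the radius as a function of the centre, hence [NNPP] and the choice
    operator. *)
Lemma continuous_strip_bounded T f X Y : 0 <= T -> continuous_strip T f ->
  exists B, 0 <= B /\ forall x y t, Rabs x <= X -> Rabs y <= Y -> 0 <= t <= T ->
    Rabs (f x y t) <= B.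
Proof.
  intros HT Hf.
  assert (Hloc : forall p : R * (R * (R * unit)), exists d : posreal,
     let '(x0, (y0, (t0, _))) := p in
     0 <= t0 <= T -> forall x y t, 0 <= t <= T ->
       Rabs (x - x0) < d -> Rabs (y - y0) < d -> Rabs (t - t0) < d ->
       Rabs (f x y t - f x0 y0 t0) < 1).
  { intros (x0 & y0 & t0 & []).
    (* Outside the strip the radius 1 is a mere default; the centres selected by compactness lie in
       the box and so in the strip. *)
    destruct (classic (0 <= t0 <= T)) as [Ht|Ht];
      [|exists (mkposreal 1 Rlt_0_1); intros; contradiction].
    specialize (Hf (x0, y0, t0) Ht (fun z => Rabs (z - f x0 y0 t0) < 1)).
    destruct Hf as [d Hd].
    { exists (mkposreal 1 Rlt_0_1). intros z Hz. exact Hz. }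
    exists d. intros _ x y t Ht' Hx Hy Hz.
    apply (Hd (x, y, t)); [|exact Ht']. repeat split; assumption. }
  apply NNPP. intros Hno.
  set (delta := fun p => proj1_sig (constructive_indefinite_description _ (Hloc p))).
  apply (compactness_list 3 (-X, (-Y, (0, tt))) (X, (Y, (T, tt))) delta).
  intros [l Hl]. apply Hno.
  exists (fold_right (fun (p : R * (R * (R * unit))) m => Rmax m (let '(x0, (y0, (t0, _))) := p in
            Rabs (f x0 y0 t0) + 1)) 0 l).
  split.
  { clear Hl. induction l; simpl; [lra|]. eapply Rle_trans; [apply IHl|apply Rmax_l]. }
  intros x y t Hx Hy Ht. apply Rabs_le_between in Hx, Hy.
  destruct (Hl (x, (y, (t, tt)))) as ((x0 & y0 & t0 & []) & Hin & Hb & Hc).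
  { simpl. repeat split; lra. }
  pose proof (proj2_sig (constructive_indefinite_description _ (Hloc (x0, (y0, (t0, tt))))))
    as Hd.
  cbv beta iota zeta in Hd.
  destruct Hb as (_ & _ & Ht0 & _), Hc as (Hc1 & Hc2 & Hc3 & _).
  assert (Hlt : Rabs (f x y t) <= Rabs (f x0 y0 t0) + 1).
  { assert (H := Hd Ht0 x y t Ht Hc1 Hc2 Hc3).
    pose proof (Rabs_triang (f x y t - f x0 y0 t0) (f x0 y0 t0)) as H'.
    replace (f x y t - f x0 y0 t0 + f x0 y0 t0) with (f x y t) in H' by ring. lra. }
  eapply Rle_trans; [exact Hlt|]. clear - Hin.
  induction l as [|p l IH]; [destruct Hin|]. simpl. destruct Hin as [->|Hin].
  - apply Rmax_r.
  - eapply Rle_trans; [now apply IH|apply Rmax_l].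
Qed.

Lemma D_in_lipschitz T f f' M a b :
  0 <= a -> a <= b -> b <= T ->
  (forall t, a <= t <= b -> D_in f f' (fun s => 0 <= s <= T) t) ->
  (forall t, a <= t <= b -> Rabs (f' t) <= M) ->
  Rabs (f b - f a) <= M * (b - a).
Proof.
  intros Ha Hab HbT Hd HM.
  destruct (Req_dec a b) as [->|Hne].
  { replace (f b - f b) with 0 by ring. rewrite Rabs_R0. lra. }
  (* one-sided derivatives at the endpoints become two-sided continuity once [f]
     is extended by constants *)
  set (clamp := fun s => Rmax a (Rmin s b)).
  assert (Hcl : forall s, a <= clamp s <= b).
  { intros s. unfold clamp, Rmax, Rmin. repeat destruct Rle_dec; lra. }
  assert (Hid : forall s, a <= s <= b -> clamp s = s).
  { intros s Hs. unfold clamp, Rmax, Rmin. repeat destruct Rle_dec; lra. }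
  assert (Hc1 : forall s t, Rabs (clamp s - clamp t) <= Rabs (s - t)).
  { intros s t. unfold clamp, Rmax, Rmin, Rabs. repeat destruct Rle_dec; repeat destruct Rcase_abs; lra. }
  destruct (MVT_gen (fun s => f (clamp s)) a b f') as (c & Hc & E).
  - intros x. rewrite Rmin_left, Rmax_right by lra. intros Hx.
    apply is_derive_Reals. intros eps Heps.
    destruct (Hd x ltac:(lra) eps Heps) as (del & Hdel & H).
    assert (Hdd : 0 < Rmin del (Rmin (x - a) (b - x)))
      by (repeat apply Rmin_glb_lt; lra).
    exists (mkposreal _ Hdd). intros k Hk0 Hk. simpl in Hk.
    pose proof (Rmin_l del (Rmin (x - a) (b - x))).
    pose proof (Rmin_r del (Rmin (x - a) (b - x))).
    pose proof (Rmin_l (x - a) (b - x)). pose proof (Rmin_r (x - a) (b - x)).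
    assert (Hk' : Rabs k < x - a /\ Rabs k < b - x) by lra.
    destruct Hk' as [Hk1 Hk2]. apply Rabs_lt_between in Hk1, Hk2.
    rewrite !Hid by lra.
    specialize (H (x + k)). simpl in H. unfold Rdist in H.
    replace (x + k - x) with k in H by ring.
    apply H. unfold D_x. repeat split; lra.
  - intros x. rewrite Rmin_left, Rmax_right by lra. intros Hx eps Heps.
    destruct (cont_deriv _ _ _ _ (Hd x Hx) eps Heps) as (del & Hdel & H).
    exists del. split; [exact Hdel|]. intros y [_ Hy].
    simpl in *. unfold Rdist in *.
    (* Clamping may send [y] onto an endpoint [x], which the punctured limit in [cont_deriv]
       excludes; there the two values coincide. *)
    destruct (Req_dec (clamp y) x) as [Heq|Hneq].
    + rewrite Heq, Hid by assumption. replace (f x - f x) with 0 by ring. now rewrite Rabs_R0.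
    + rewrite (Hid x Hx). apply H. repeat split.
      * pose proof (Hcl y); lra.
      * pose proof (Hcl y); lra.
      * lra.
      * eapply Rle_lt_trans; [|exact Hy]. rewrite <- (Hid x Hx) at 1. apply Hc1.
  - rewrite !Hid in E by lra. rewrite E, Rabs_mult, (Rabs_pos_eq (b - a)) by lra.
    apply Rmult_le_compat_r; [lra|]. apply HM.
    rewrite Rmin_left, Rmax_right in Hc by lra. exact Hc.
Qed.

(** Subtracting the tangent at [a] changes nothing, since affine functions are interpolated exactly.
    The remainder [phi] is at most [M * (b - a) ^ 2] by two applications of the mean value
    inequality, and it is evaluated at two points, hence the factor 2. *)
Lemma linear_interpolation T f f1 f2 M a b th :
  0 <= a -> a <= b -> b <= T -> 0 <= th <= 1 ->
  (forall t, 0 <= t <= T -> D_in f f1 (fun s => 0 <= s <= T) t) ->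
  (forall t, 0 <= t <= T -> D_in f1 f2 (fun s => 0 <= s <= T) t) ->
  (forall t, 0 <= t <= T -> Rabs (f2 t) <= M) ->
  Rabs (f (a + th * (b - a)) - ((1 - th) * f a + th * f b)) <= 2 * M * (b - a) ^ 2.
Proof.
  intros Ha Hab HbT Hth H1 H2 HM.
  set (phi := fun t => f t - f a - f1 a * (t - a)).
  assert (HM0 : 0 <= M) by (eapply Rle_trans; [apply Rabs_pos|apply (HM a); lra]).
  assert (Hphi : forall s, a <= s <= b -> Rabs (phi s) <= M * (b - a) ^ 2).
  { intros s Hs.
    pose proof (D_in_lipschitz T phi (fun t => f1 t - f1 a) (M * (b - a)) a s) as X.
    assert (phi a = 0) as E by (unfold phi; ring). rewrite E, Rminus_0_r in X.
    eapply Rle_trans; [apply X|]; try lra.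
    - intros t Ht eps Heps. destruct (H1 t ltac:(lra) eps Heps) as (del & Hdel & H).
      exists del. split; [exact Hdel|]. intros y Hy. specialize (H y Hy).
      simpl in *. unfold Rdist in *. destruct Hy as [[_ Hy] _].
      replace ((phi y - phi t) / (y - t) - (f1 t - f1 a)) with ((f y - f t) / (y - t) - f1 t);
        [exact H|]. unfold phi. field. lra.
    - intros t Ht. eapply Rle_trans;
        [apply (D_in_lipschitz T f1 f2 M a t); try lra; intros; [apply H2|apply HM]; lra|].
      apply Rmult_le_compat_l; lra.
    - replace (M * (b - a) ^ 2) with (M * (b - a) * (b - a)) by ring.
      apply Rmult_le_compat_l; [|lra]. apply Rmult_le_pos; lra. }
  assert (Hs : a <= a + th * (b - a) <= b) by nra.
  replace (_ - _) with (phi (a + th * (b - a)) - th * phi b) by (unfold phi; ring).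
  pose proof (Hphi _ Hs) as X1. pose proof (Hphi b ltac:(lra)) as X2.
  eapply Rle_trans; [apply Rabs_triang|]. rewrite Rabs_Ropp, Rabs_mult, (Rabs_pos_eq th) by lra.
  pose proof (Rabs_pos (phi b)).
  assert (th * Rabs (phi b) <= Rabs (phi b)) by nra. lra.
Qed.

(** The Lagrange basis at the nodes 0, 1, 2, 3. *)
Definition cubic_basis (i : nat) (th : R) : R :=
  match i with
  | O => - ((th - 1) * (th - 2) * (th - 3) / 6)
  | 1%nat => th * (th - 2) * (th - 3) / 2
  | 2%nat => - (th * (th - 1) * (th - 3) / 2)
  | _ => th * (th - 1) * (th - 2) / 6
  end.

Lemma cubic_basis_bound i th : 0 <= th <= 1 -> Rabs (cubic_basis i th) <= 3.
Proof.
  intros H. apply Rabs_le.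
  assert (0 <= th * (1 - th)) by nra.
  assert (0 <= th * (2 - th) <= 2) by nra.
  assert (0 <= (1 - th) * (2 - th) <= 2) by nra.
  destruct i as [|[|[|i]]]; simpl; nra.
Qed.

Lemma sum_four (f : nat -> R) : sum_n_m f 0 3 = f 0%nat + f 1%nat + f 2%nat + f 3%nat.
Proof.
  rewrite !sum_n_Sm, sum_n_n by lia. unfold plus; simpl. ring.
Qed.

(** The remainder of the cubic Taylor polynomial at [x0] is bounded by four integrations over a
    radius [3 * s], the reach of the stencil: [81 * M * s ^ 4]. It enters once at the evaluation
    point and at four nodes with weights at most 3, and [81 * (1 + 4 * 3) = 1053]. *)
Lemma cubic_interpolation f f1 f2 f3 f4 x0 s M th :
  0 <= s -> 0 <= th <= 1 ->
  (forall z, is_derive f z (f1 z)) -> (forall z, is_derive f1 z (f2 z)) ->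
  (forall z, is_derive f2 z (f3 z)) -> (forall z, is_derive f3 z (f4 z)) ->
  (forall z, Rabs (z - x0) <= 3 * s -> Rabs (f4 z) <= M) ->
  Rabs (f (x0 + th * s) - sum_n_m (fun i => f (x0 + INR i * s) * cubic_basis i th) 0 3)
    <= 1053 * M * s ^ 4.
Proof.
  intros Hs Hth D1 D2 D3 D4 HM.
  assert (step : forall g g' A, g x0 = 0 -> (forall z, is_derive g z (g' z)) ->
    (forall z, Rabs (z - x0) <= 3 * s -> Rabs (g' z) <= A) ->
    forall z, Rabs (z - x0) <= 3 * s -> Rabs (g z) <= A * (3 * s)).
  { intros g g' A Hg0 Hg HA z Hz.
    assert (0 <= A).
    { eapply Rle_trans; [apply Rabs_pos|apply (HA x0)].
      replace (x0 - x0) with 0 by ring. rewrite Rabs_R0. lra. }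
    replace (g z) with (g z - g x0) by (rewrite Hg0; ring).
    eapply Rle_trans; [apply (bounded_variation g g' A)|].
    - intros t Ht. split; [apply Hg|apply HA; lra].
    - now apply Rmult_le_compat_l. }
  set (r3 := fun z => f3 z - f3 x0).
  set (r2 := fun z => f2 z - (f2 x0 + f3 x0 * (z - x0))).
  set (r1 := fun z => f1 z - (f1 x0 + f2 x0 * (z - x0) + f3 x0 * (z - x0) ^ 2 / 2)).
  set (r := fun z => f z - (f x0 + f1 x0 * (z - x0) + f2 x0 * (z - x0) ^ 2 / 2
                            + f3 x0 * (z - x0) ^ 3 / 6)).
  assert (R3 : forall z, Rabs (z - x0) <= 3 * s -> Rabs (r3 z) <= M * (3 * s)).
  { apply (step r3 f4); [unfold r3; ring| |exact HM].
    intros z. unfold r3. replace (f4 z) with (f4 z - 0) by ring.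
    apply (is_derive_minus f3 (fun _ => f3 x0) z (f4 z) 0); [apply D4|].
    apply (is_derive_const (f3 x0) z). }
  assert (R2 : forall z, Rabs (z - x0) <= 3 * s -> Rabs (r2 z) <= M * (3 * s) * (3 * s)).
  { apply (step r2 r3); [unfold r2; ring| |exact R3].
    intros z. apply (is_derive_minus f2 (fun z => f2 x0 + f3 x0 * (z - x0)) z (f3 z) (f3 x0));
      [apply D3|]. auto_derive; auto; ring. }
  assert (R1 : forall z, Rabs (z - x0) <= 3 * s ->
     Rabs (r1 z) <= M * (3 * s) * (3 * s) * (3 * s)).
  { apply (step r1 r2); [unfold r1; field| |exact R2].
    intros z. apply (is_derive_minus f1
      (fun z => f1 x0 + f2 x0 * (z - x0) + f3 x0 * (z - x0) ^ 2 / 2) z (f2 z)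
      (f2 x0 + f3 x0 * (z - x0))); [apply D2|]. auto_derive; auto; field. }
  assert (R0 : forall z, Rabs (z - x0) <= 3 * s ->
     Rabs (r z) <= M * (3 * s) * (3 * s) * (3 * s) * (3 * s)).
  { apply (step r r1); [unfold r; field| |exact R1].
    intros z. apply (is_derive_minus f
      (fun z => f x0 + f1 x0 * (z - x0) + f2 x0 * (z - x0) ^ 2 / 2 + f3 x0 * (z - x0) ^ 3 / 6)
      z (f1 z) (f1 x0 + f2 x0 * (z - x0) + f3 x0 * (z - x0) ^ 2 / 2));
      [apply D1|]. auto_derive; auto; field. }
  rewrite sum_four.
  (* Lagrange interpolation at four nodes reproduces the cubic Taylor polynomial. *)
  replace (_ - _) with (r (x0 + th * s) - (r (x0 + 0 * s) * cubic_basis 0 th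
     + r (x0 + 1 * s) * cubic_basis 1 th + r (x0 + 2 * s) * cubic_basis 2 th
     + r (x0 + 3 * s) * cubic_basis 3 th)).
  2: { unfold r, cubic_basis. simpl INR.
       replace (x0 + (1 + 1) * s) with (x0 + 2 * s) by ring.
       replace (x0 + (1 + 1 + 1) * s) with (x0 + 3 * s) by ring. field. }
  set (A := M * (3 * s) * (3 * s) * (3 * s) * (3 * s)) in *.
  assert (Hr : forall c, 0 <= c <= 3 -> Rabs (r (x0 + c * s)) <= A).
  { intros c Hc. apply R0. replace (x0 + c * s - x0) with (c * s) by ring.
    rewrite Rabs_pos_eq by nra. nra. }
  assert (Hp : forall c i, 0 <= c <= 3 ->
     Rabs (r (x0 + c * s) * cubic_basis i th) <= A * 3).
  { intros c i Hc. rewrite Rabs_mult.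
    apply Rmult_le_compat; auto using Rabs_pos, cubic_basis_bound. }
  pose proof (Hr th ltac:(lra)) as X. pose proof (Hp 0 0%nat ltac:(lra)) as X0.
  pose proof (Hp 1 1%nat ltac:(lra)) as X1. pose proof (Hp 2 2%nat ltac:(lra)) as X2.
  pose proof (Hp 3 3%nat ltac:(lra)) as X3.
  apply Rabs_le_between in X, X0, X1, X2, X3.
  replace (1053 * M * s ^ 4) with (13 * A) by (unfold A; ring).
  apply Rabs_le. lra.
Qed.

Lemma C_space_chain_x T f : C_space T 4 f -> exists f1 f2 f3 f4,
  is_deriv_x T f f1 /\ is_deriv_x T f1 f2 /\ is_deriv_x T f2 f3 /\ is_deriv_x T f3 f4 /\
  continuous_strip T f1 /\ continuous_strip T f4.
Proof.
  intros (_ & f1 & _ & D1 & _ & (Hc1 & f2 & _ & D2 & _ & (_ & f3 & _ & D3 & _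
    & (_ & f4 & _ & D4 & _ & (Hc4 & _) & _) & _) & _) & _).
  exists f1, f2, f3, f4. tauto.
Qed.

Lemma C_space_chain_y T f : C_space T 4 f -> exists f1 f2 f3 f4,
  is_deriv_y T f f1 /\ is_deriv_y T f1 f2 /\ is_deriv_y T f2 f3 /\ is_deriv_y T f3 f4 /\
  continuous_strip T f1 /\ continuous_strip T f4.
Proof.
  intros (_ & _ & f1 & _ & D1 & _ & (Hc1 & _ & f2 & _ & D2 & _ & (_ & _ & f3 & _ & D3 & _
    & (_ & _ & f4 & _ & D4 & _ & (Hc4 & _))))).
  exists f1, f2, f3, f4. tauto.
Qed.

(** Stencils leave the period cell, by up to three coarse steps of at most one period each, so
    bounds are taken on a wider box. The factor 10 leaves room: the interpolation stencils stay
    within 7 periods of the origin, and the points between the two arguments of the Lipschitz bounds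
    within 9. *)
Lemma smooth_bounds T L1 L2 u : 0 < T -> 0 < L1 -> 0 < L2 -> C42 T u ->
  exists B, 0 <= B /\
  (forall x y t, Rabs x <= 10 * L1 -> Rabs y <= 10 * L2 -> 0 <= t <= T ->
     Rabs (u x y t) <= B) /\
  (forall x x' y t, Rabs x <= 3 * L1 -> Rabs x' <= 3 * L1 -> Rabs y <= 10 * L2 ->
     0 <= t <= T -> Rabs (u x' y t - u x y t) <= B * Rabs (x' - x)) /\
  (forall x y y' t, Rabs x <= 10 * L1 -> Rabs y <= 3 * L2 -> Rabs y' <= 3 * L2 ->
     0 <= t <= T -> Rabs (u x y' t - u x y t) <= B * Rabs (y' - y)) /\
  (forall x y t s th, Rabs x <= 4 * L1 -> Rabs y <= 10 * L2 -> 0 <= t <= T ->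
     0 <= s <= L1 -> 0 <= th <= 1 ->
     Rabs (u (x + th * s) y t
           - sum_n_m (fun i => u (x + INR i * s) y t * cubic_basis i th) 0 3) <= B * s ^ 4) /\
  (forall x y t s th, Rabs x <= 10 * L1 -> Rabs y <= 4 * L2 -> 0 <= t <= T ->
     0 <= s <= L2 -> 0 <= th <= 1 ->
     Rabs (u x (y + th * s) t
           - sum_n_m (fun i => u x (y + INR i * s) t * cubic_basis i th) 0 3) <= B * s ^ 4) /\
  (forall x y a b th, Rabs x <= 10 * L1 -> Rabs y <= 10 * L2 ->
     0 <= a -> a <= b -> b <= T -> 0 <= th <= 1 ->
     Rabs (u x y (a + th * (b - a)) - ((1 - th) * u x y a + th * u x y b)) <= B * (b - a) ^ 2).
Proof.
  intros HT HL1 HL2 [HS (_ & ut & Dt & _ & utt & Dtt & Htt & _)].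
  destruct (C_space_chain_x T u HS) as (x1 & x2 & x3 & x4 & X1 & X2 & X3 & X4 & Cx1 & Cx4).
  destruct (C_space_chain_y T u HS) as (y1 & y2 & y3 & y4 & Y1 & Y2 & Y3 & Y4 & Cy1 & Cy4).
  destruct HS as [Hu _].
  destruct (continuous_strip_bounded T u (10 * L1) (10 * L2) ltac:(lra) Hu) as (B0 & HB0 & B0P).
  destruct (continuous_strip_bounded T x1 (10 * L1) (10 * L2) ltac:(lra) Cx1) as (B1 & HB1 & B1P).
  destruct (continuous_strip_bounded T y1 (10 * L1) (10 * L2) ltac:(lra) Cy1) as (B2 & HB2 & B2P).
  destruct (continuous_strip_bounded T x4 (10 * L1) (10 * L2) ltac:(lra) Cx4) as (B3 & HB3 & B3P).
  destruct (continuous_strip_bounded T y4 (10 * L1) (10 * L2) ltac:(lra) Cy4) as (B4 & HB4 & B4P).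
  destruct (continuous_strip_bounded T utt (10 * L1) (10 * L2) ltac:(lra) Htt) as (B5 & HB5 & B5P).
  exists (B0 + B1 + B2 + 1053 * B3 + 1053 * B4 + 2 * B5).
  split; [lra|]. split; [|split; [|split; [|split; [|split]]]].
  - intros x y t Hx Hy Ht. pose proof (B0P x y t Hx Hy Ht). lra.
  - intros x x' y t Hx Hx' Hy Ht. apply Rle_trans with (B1 * Rabs (x' - x)).
    + apply (bounded_variation (fun z => u z y t) (fun z => x1 z y t)).
      intros z Hz. split; [now apply X1|]. apply B1P; auto.
      revert Hx Hx' Hz. unfold Rabs. repeat destruct Rcase_abs; lra.
    + apply Rmult_le_compat_r; [apply Rabs_pos|lra].
  - intros x y y' t Hx Hy Hy' Ht. apply Rle_trans with (B2 * Rabs (y' - y)).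
    + apply (bounded_variation (fun z => u x z t) (fun z => y1 x z t)).
      intros z Hz. split; [now apply Y1|]. apply B2P; auto.
      revert Hy Hy' Hz. unfold Rabs. repeat destruct Rcase_abs; lra.
    + apply Rmult_le_compat_r; [apply Rabs_pos|lra].
  - intros x y t s th Hx Hy Ht Hs Hth. apply Rle_trans with (1053 * B3 * s ^ 4).
    + apply (cubic_interpolation (fun z => u z y t) (fun z => x1 z y t) (fun z => x2 z y t)
        (fun z => x3 z y t) (fun z => x4 z y t)); try lra;
        [intros z; now apply X1|intros z; now apply X2|intros z; now apply X3
        |intros z; now apply X4|].
      intros z Hz. apply B3P; auto.
      revert Hx Hz. unfold Rabs. repeat destruct Rcase_abs; lra.
    + apply Rmult_le_compat_r; [apply pow_le; lra|lra].
  - intros x y t s th Hx Hy Ht Hs Hth. apply Rle_trans with (1053 * B4 * s ^ 4).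
    + apply (cubic_interpolation (fun z => u x z t) (fun z => y1 x z t) (fun z => y2 x z t)
        (fun z => y3 x z t) (fun z => y4 x z t)); try lra;
        [intros z; now apply Y1|intros z; now apply Y2|intros z; now apply Y3
        |intros z; now apply Y4|].
      intros z Hz. apply B4P; auto.
      revert Hy Hz. unfold Rabs. repeat destruct Rcase_abs; lra.
    + apply Rmult_le_compat_r; [apply pow_le; lra|lra].
  - intros x y a b th Hx Hy Ha Hab Hb Hth. apply Rle_trans with (2 * B5 * (b - a) ^ 2).
    + apply (linear_interpolation T (u x y) (ut x y) (utt x y)); auto.
    + apply Rmult_le_compat_r; [apply pow2_ge_0|lra].
Qed.

(** * The space-time interpolation of the coarse solution *)

Lemma sum_four_sq (f : nat -> R) :
  sum_n_m f 0 3 ^ 2 <= 4 * sum_n_m (fun i => f i ^ 2) 0 3.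
Proof.
  rewrite !sum_four. generalize (f 0%nat) (f 1%nat) (f 2%nat) (f 3%nat). intros a b c d.
  pose proof (pow2_ge_0 (a - b)). pose proof (pow2_ge_0 (a - c)). pose proof (pow2_ge_0 (a - d)).
  pose proof (pow2_ge_0 (b - c)). pose proof (pow2_ge_0 (b - d)). pose proof (pow2_ge_0 (c - d)).
  nra.
Qed.

Lemma sum_four_le (f g : nat -> R) : (forall i, f i <= g i) ->
  sum_n_m f 0 3 <= sum_n_m g 0 3.
Proof.
  intros H. rewrite !sum_four.
  pose proof (H 0%nat); pose proof (H 1%nat); pose proof (H 2%nat); pose proof (H 3%nat). lra.
Qed.

Lemma sum_four_scal c (f : nat -> R) :
  c * sum_n_m f 0 3 = sum_n_m (fun i => c * f i) 0 3.
Proof. rewrite !sum_four. ring. Qed.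

Lemma cell_sum_sum_four M1 M2 (f : nat -> gridfun) :
  cell_sum M1 M2 (fun a b => sum_n_m (fun i => f i a b) 0 3)
  = sum_n_m (fun i => cell_sum M1 M2 (f i)) 0 3.
Proof.
  rewrite sum_four.
  rewrite (cell_sum_ext _ _ _ (fun a b => f 0%nat a b + f 1%nat a b + f 2%nat a b + f 3%nat a b))
    by (intros; apply sum_four).
  now rewrite !cell_sum_plus.
Qed.

Lemma cell_sum_translate M1 M2 f (i j : nat) : periodic M1 M2 f ->
  cell_sum M1 M2 (fun a b => f (a + Z.of_nat i)%Z (b + Z.of_nat j)%Z) = cell_sum M1 M2 f.
Proof.
  intros Hf.
  assert (HP : forall i j, periodic M1 M2 (fun a b => f (a + Z.of_nat i)%Z (b + Z.of_nat j)%Z)).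
  { intros i' j' a b. split; rewrite (Z.add_shuffle0 _ (Z.of_nat _) (Z.of_nat _)); apply Hf. }
  induction i as [|i IHi].
  - induction j as [|j IHj].
    + apply cell_sum_ext; intros; now rewrite !Z.add_0_r.
    + rewrite <- IHj. symmetry. rewrite <- (cell_sum_fwd M1 M2 false) by apply HP.
      apply cell_sum_ext; intros; unfold fwd. f_equal; lia.
  - rewrite <- IHi. symmetry. rewrite <- (cell_sum_fwd M1 M2 true) by apply HP.
    apply cell_sum_ext; intros; unfold fwd. f_equal; lia.
Qed.

Lemma cell_sum_refine k M1 M2 (G : gridfun) : (1 <= k)%nat ->
  cell_sum (k * M1) (k * M2) (fun a b => G (a / Z.of_nat k)%Z (b / Z.of_nat k)%Z)
  = INR k ^ 2 * cell_sum M1 M2 G.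
Proof.
  intros Hk. unfold cell_sum.
  rewrite (zsum_ext _ _ (fun a => INR k * zsum M2 (fun b => G (a / Z.of_nat k)%Z b)))
    by (intros; now rewrite (zsum_div k M2 (fun b => G (a / Z.of_nat k)%Z b))).
  rewrite zsum_scal, (zsum_div k M1 (fun a => zsum M2 (fun b => G a b))) by assumption. ring.
Qed.

(** The nodes are equispaced: translating by [p] and scaling by the coarse step [K * h] leaves only
    the fractional position [l / K] inside the cell. *)
Lemma lagrange_cubic_basis (K p l : Z) (h : R) (i : nat) :
  (0 < K)%Z -> 0 < h -> (i <= 3)%nat ->
  lagrange (fun s => IZR ((p + Z.of_nat s) * K) * h) i (IZR (p * K + l) * h)
  = cubic_basis i (IZR l / IZR K).
Proof.
  intros HK Hh Hi. apply IZR_lt in HK.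
  pose proof (Rmult_lt_0_compat _ _ HK Hh). unfold lagrange.
  destruct i as [|[|[|[|i]]]]; [| | | |lia]; cbn -[IZR Z.mul Z.add INR];
    rewrite !plus_IZR, !mult_IZR, !plus_IZR; simpl IZR; field;
    repeat split; intros E; lra.
Qed.

Lemma div_mod_cell (K M : nat) (a : Z) : (1 <= K)%nat -> (0 <= a < Z.of_nat (K * M))%Z ->
  let p := (a / Z.of_nat K)%Z in let l := (a mod Z.of_nat K)%Z in
  a = (p * Z.of_nat K + l)%Z /\ (0 <= p <= Z.of_nat M - 1)%Z /\ (0 <= l <= Z.of_nat K - 1)%Z.
Proof.
  intros HK Ha p l. pose proof (Z.div_mod a (Z.of_nat K) ltac:(lia)) as E.
  pose proof (Z.mod_pos_bound a (Z.of_nat K) ltac:(lia)) as Hl.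
  fold p l in E, Hl. rewrite Nat2Z.inj_mul in Ha. repeat split; nia.
Qed.

Section Interpolation.
Variables (T L1 L2 B : R) (u : R -> R -> R -> R).
Variables (kh kt : nat) (hc tauc : R) (M1 M2 N : nat) (uf : nat -> gridfun).

Let K := Z.of_nat kh.
Let hf := hc / INR kh.
Let tauf := tauc / INR kt.
Let U := sample hf tauf u.

Hypotheses (kh_pos : (1 <= kh)%nat) (kt_pos : (1 <= kt)%nat) (B_pos : 0 <= B)
  (T_pos : 0 < T) (grid : is_grid L1 L2 T hc tauc M1 M2 N)
  (uf_periodic : in_V (kh * M1) (kh * M2) (kt * N) uf)
  (U_periodic : in_V (kh * M1) (kh * M2) (kt * N) U).

Lemma grid_facts :
  0 < INR kh /\ 0 < INR kt /\ 0 < hc /\ 0 < hf /\ 1 <= INR M1 /\ 1 <= INR M2 /\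
  1 <= INR N /\ 0 < tauc /\ 0 < tauf /\ tauc * INR N = T /\ hc <= L1 /\ hc <= L2.
Proof.
  destruct grid as (H1 & H2 & H3 & Hh & E1 & E2 & E3).
  apply le_INR in H1, H2, H3, kh_pos, kt_pos. simpl in H1, H2, H3, kh_pos, kt_pos.
  assert (0 < tauc) by (rewrite E3; apply Rdiv_lt_0_compat; lra).
  assert (0 < hf) by (apply Rdiv_lt_0_compat; lra).
  assert (0 < tauf) by (apply Rdiv_lt_0_compat; lra).
  assert (tauc * INR N = T) by (rewrite E3; field; lra).
  assert (hc <= L1) by nra. assert (hc <= L2) by nra.
  assert (0 < INR kh) by lra. assert (0 < INR kt) by lra.
  repeat (split; [assumption|]). assumption.
Qed.

Lemma coarse_node p : IZR (p * K) * hf = IZR p * hc.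
Proof.
  pose proof grid_facts. unfold hf, K. rewrite mult_IZR, <- INR_IZR_INZ. field. lra.
Qed.

Lemma fine_time n : (n <= kt * N)%nat -> 0 <= INR n * tauf <= T.
Proof.
  intros Hn. pose proof grid_facts as G. apply le_INR in Hn. rewrite mult_INR in Hn.
  split; [apply Rmult_le_pos; [apply pos_INR|lra]|].
  replace T with (INR kt * INR N * tauf).
  - apply Rmult_le_compat_r; lra.
  - unfold tauf. replace T with (tauc * INR N) by tauto. field. lra.
Qed.

(** The error of [uf] at coarse spatial nodes and fine times. It separates the two interpolations:
    time interpolation acts only inside [nodal], space interpolation only spreads [nodal] to the
    other nodes. *)
Let nodal (n : nat) : gridfun :=
  fun p q => U n (p * K)%Z (q * K)%Z - uf n (p * K)%Z (q * K)%Z.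

Hypothesis cubic_x : forall x y t s th, Rabs x <= 4 * L1 -> Rabs y <= 10 * L2 -> 0 <= t <= T ->
  0 <= s <= L1 -> 0 <= th <= 1 ->
  Rabs (u (x + th * s) y t
        - sum_n_m (fun i => u (x + INR i * s) y t * cubic_basis i th) 0 3) <= B * s ^ 4.
Hypothesis cubic_y : forall x y t s th, Rabs x <= 10 * L1 -> Rabs y <= 4 * L2 -> 0 <= t <= T ->
  0 <= s <= L2 -> 0 <= th <= 1 ->
  Rabs (u x (y + th * s) t
        - sum_n_m (fun i => u x (y + INR i * s) t * cubic_basis i th) 0 3) <= B * s ^ 4.
Hypothesis interpolates_in_space : forall (n : nat) (p q l m : Z),
  (n <= kt * N)%nat ->
  (0 <= p <= Z.of_nat M1 - 1)%Z -> (0 <= q <= Z.of_nat M2 - 1)%Z ->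
  (0 <= l <= K - 1)%Z -> (0 <= m <= K - 1)%Z ->
  uf n (p * K + l)%Z (q * K + m)%Z =
    sum_n_m (fun i => sum_n_m (fun j =>
      uf n ((p + Z.of_nat i) * K)%Z ((q + Z.of_nat j) * K)%Z
      * lagrange (fun s => IZR ((p + Z.of_nat s) * K) * hf) i (IZR (p * K + l) * hf)
      * lagrange (fun s => IZR ((q + Z.of_nat s) * K) * hf) j (IZR (q * K + m) * hf))
      0 3) 0 3.

(** Adding and subtracting the interpolant of exact values separates smooth errors from propagated
    nodal ones. The 13 is one error in [x] plus four errors in [y] weighted by basis values at most
    3. The 2592 is [2 * 16 * 81]: the splitting into two parts, Cauchy-Schwarz over 16 stencil
    nodes, and the squared product of two basis values. *)
Lemma interpolation_pointwise n p q l m :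
  (n <= kt * N)%nat ->
  (0 <= p <= Z.of_nat M1 - 1)%Z -> (0 <= q <= Z.of_nat M2 - 1)%Z ->
  (0 <= l <= K - 1)%Z -> (0 <= m <= K - 1)%Z ->
  (U n (p * K + l)%Z (q * K + m)%Z - uf n (p * K + l)%Z (q * K + m)%Z) ^ 2 <=
  2 * (13 * B * hc ^ 4) ^ 2
  + 2592 * sum_n_m (fun i => sum_n_m (fun j =>
       nodal n (p + Z.of_nat i)%Z (q + Z.of_nat j)%Z ^ 2) 0 3) 0 3.
Proof.
  intros Hn Hp Hq Hl Hm. pose proof grid_facts
    as (G1 & G2 & G3 & G4 & G5 & G6 & G7 & G8 & G9 & G10 & G11 & G12).
  pose proof (fine_time n Hn) as Ht.
  destruct grid as (_ & _ & _ & _ & E1 & E2 & _).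
  assert (HKR : 0 < IZR K) by (unfold K; rewrite <- INR_IZR_INZ; assumption).
  assert (HhK : hc = IZR K * hf) by (unfold hf, K; rewrite <- INR_IZR_INZ; field; lra).
  rewrite interpolates_in_space by assumption.
  set (th := IZR l / IZR K). set (ph := IZR m / IZR K).
  assert (Hfrac : forall l, (0 <= l <= K - 1)%Z -> 0 <= IZR l / IZR K <= 1).
  { intros z [Hz1 Hz2]. apply IZR_le in Hz1, Hz2. rewrite minus_IZR in Hz2.
    split; [apply Rmult_le_pos; [lra|left; now apply Rinv_0_lt_compat]|].
    apply Rmult_le_reg_r with (IZR K); [assumption|].
    replace (IZR z / IZR K * IZR K) with (IZR z) by (field; lra). lra. }
  pose proof (Hfrac l Hl) as Hth. pose proof (Hfrac m Hm) as Hph. fold th in Hth. fold ph in Hph.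
  set (x0 := IZR p * hc). set (y0 := IZR q * hc). set (t := INR n * tauf) in *.
  assert (Hx0 : 0 <= x0 <= L1).
  { destruct Hp as [Hp1 Hp2]. apply IZR_le in Hp1, Hp2. rewrite minus_IZR, <- INR_IZR_INZ in Hp2.
    unfold x0. rewrite E1. nra. }
  assert (Hy0 : 0 <= y0 <= L2).
  { destruct Hq as [Hq1 Hq2]. apply IZR_le in Hq1, Hq2. rewrite minus_IZR, <- INR_IZR_INZ in Hq2.
    unfold y0. rewrite E2. nra. }
  assert (Nx : forall i, IZR ((p + Z.of_nat i) * K) * hf = x0 + INR i * hc).
  { intros i. rewrite coarse_node, plus_IZR, <- INR_IZR_INZ. unfold x0. ring. }
  assert (Ny : forall i, IZR ((q + Z.of_nat i) * K) * hf = y0 + INR i * hc).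
  { intros i. rewrite coarse_node, plus_IZR, <- INR_IZR_INZ. unfold y0. ring. }
  assert (Ex : U n (p * K + l)%Z (q * K + m)%Z = u (x0 + th * hc) (y0 + ph * hc) t).
  { unfold U, sample, x0, y0, th, ph, t. f_equal; rewrite plus_IZR, mult_IZR, HhK; field; lra. }
  rewrite Ex. clear Ex.
  set (R1 := u (x0 + th * hc) (y0 + ph * hc) t
    - sum_n_m (fun i => u (x0 + INR i * hc) (y0 + ph * hc) t * cubic_basis i th) 0 3).
  set (R2 := fun i => u (x0 + INR i * hc) (y0 + ph * hc) t
    - sum_n_m (fun j => u (x0 + INR i * hc) (y0 + INR j * hc) t * cubic_basis j ph) 0 3).
  set (w := fun i j : nat => nodal n (p + Z.of_nat i)%Z (q + Z.of_nat j)%Z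
                       * cubic_basis i th * cubic_basis j ph).
  set (Y := sum_n_m (fun i => sum_n_m (fun j => w i j) 0 3) 0 3).
  (* [R1] is the error of interpolating in [x] alone, [R2 i] that of interpolating in [y] along the
     [i]-th node line, and [Y] collects the nodal errors. *)
  assert (Dec : u (x0 + th * hc) (y0 + ph * hc) t -
     sum_n_m (fun i => sum_n_m (fun j =>
      uf n ((p + Z.of_nat i) * K)%Z ((q + Z.of_nat j) * K)%Z
      * lagrange (fun s => IZR ((p + Z.of_nat s) * K) * hf) i (IZR (p * K + l) * hf)
      * lagrange (fun s => IZR ((q + Z.of_nat s) * K) * hf) j (IZR (q * K + m) * hf))
      0 3) 0 3 = (R1 + sum_n_m (fun i => R2 i * cubic_basis i th) 0 3) + Y).
  { unfold Y, w, R1, R2, nodal, U, sample. rewrite !sum_four.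
    assert (HK : (0 < K)%Z) by (unfold K; lia).
    rewrite !lagrange_cubic_basis by (assumption || lia).
    fold th ph t. rewrite !Nx, !Ny. ring. }
  rewrite Dec. clear Dec.
  assert (Hh4 : 0 <= B * hc ^ 4) by (apply Rmult_le_pos; [assumption|apply pow_le; lra]).
  assert (HX : Rabs (R1 + sum_n_m (fun i => R2 i * cubic_basis i th) 0 3) <= 13 * B * hc ^ 4).
  { assert (HR1 : Rabs R1 <= B * hc ^ 4).
    { apply cubic_x; try lra; rewrite ?Rabs_pos_eq; nra. }
    assert (HR2 : forall i, (i <= 3)%nat -> Rabs (R2 i * cubic_basis i th) <= B * hc ^ 4 * 3).
    { intros i Hi. apply le_INR in Hi. simpl in Hi. pose proof (pos_INR i).
      rewrite Rabs_mult. apply Rmult_le_compat; auto using Rabs_pos, cubic_basis_bound.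
      apply cubic_y; try lra; rewrite Rabs_pos_eq; nra. }
    rewrite sum_four.
    pose proof (HR2 0%nat ltac:(lia)) as Z0. pose proof (HR2 1%nat ltac:(lia)) as Z1.
    pose proof (HR2 2%nat ltac:(lia)) as Z2. pose proof (HR2 3%nat ltac:(lia)) as Z3.
    apply Rabs_le_between in HR1, Z0, Z1, Z2, Z3. apply Rabs_le. lra. }
  assert (HY : Y ^ 2 <= 1296 * sum_n_m (fun i => sum_n_m (fun j =>
       nodal n (p + Z.of_nat i)%Z (q + Z.of_nat j)%Z ^ 2) 0 3) 0 3).
  { unfold Y. eapply Rle_trans; [apply sum_four_sq|].
    replace 1296 with (4 * 324) by ring. rewrite Rmult_assoc. apply Rmult_le_compat_l; [lra|].
    rewrite sum_four_scal. apply sum_four_le. intros i.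
    eapply Rle_trans; [apply sum_four_sq|].
    replace 324 with (4 * 81) by ring. rewrite Rmult_assoc. apply Rmult_le_compat_l; [lra|].
    rewrite sum_four_scal. apply sum_four_le. intros j. unfold w.
    rewrite !Rpow_mult_distr.
    pose proof (cubic_basis_bound i th Hth) as C1. pose proof (cubic_basis_bound j ph Hph) as C2.
    assert (Q1 : cubic_basis i th ^ 2 <= 3 ^ 2).
    { rewrite <- pow2_abs. apply pow_incr. split; [apply Rabs_pos|assumption]. }
    assert (Q2 : cubic_basis j ph ^ 2 <= 3 ^ 2).
    { rewrite <- pow2_abs. apply pow_incr. split; [apply Rabs_pos|assumption]. }
    pose proof (pow2_ge_0 (nodal n (p + Z.of_nat i)%Z (q + Z.of_nat j)%Z)).
    pose proof (pow2_ge_0 (cubic_basis i th)). pose proof (pow2_ge_0 (cubic_basis j ph)).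
    rewrite Rmult_assoc, (Rmult_comm 81). apply Rmult_le_compat_l; [assumption|].
    replace 81 with (3 ^ 2 * 3 ^ 2) by ring. apply Rmult_le_compat; assumption. }
  set (X := R1 + _) in *.
  assert (HX2 : X ^ 2 <= (13 * B * hc ^ 4) ^ 2).
  { rewrite <- pow2_abs. apply pow_incr. split; [apply Rabs_pos|assumption]. }
  pose proof (pow2_ge_0 (X - Y)). lra.
Qed.

Lemma nodal_periodic n : (n <= kt * N)%nat -> periodic M1 M2 (nodal n).
Proof.
  intros Hn a b. unfold nodal.
  pose proof (uf_periodic n Hn (a * K)%Z (b * K)%Z) as [F1 F2].
  pose proof (U_periodic n Hn (a * K)%Z (b * K)%Z) as [F3 F4].
  replace ((a + Z.of_nat M1) * K)%Z with (a * K + Z.of_nat (kh * M1))%Z by (unfold K; lia).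
  replace ((b + Z.of_nat M2) * K)%Z with (b * K + Z.of_nat (kh * M2))%Z by (unfold K; lia).
  rewrite F1, F2, F3, F4. auto.
Qed.

(** Each coarse node belongs to 16 stencils, and [16 * 2592 = 41472]. Each coarse cell holds
    [kh ^ 2] fine nodes, which turns the weight [hf ^ 2] into [hc ^ 2]. *)
Lemma interpolation_norm n : (n <= kt * N)%nat ->
  hf ^ 2 * cell_sum (kh * M1) (kh * M2) (fun a b => (U n a b - uf n a b) ^ 2) <=
  2 * (13 * B * hc ^ 4) ^ 2 * (L1 * L2)
  + 41472 * (hc ^ 2 * cell_sum M1 M2 (fun p q => nodal n p q ^ 2)).
Proof.
  intros Hn. pose proof grid_facts as G.
  destruct grid as (_ & _ & _ & _ & E1 & E2 & _).
  pose proof (nodal_periodic n Hn) as HP.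
  set (g := fun p q => sum_n_m (fun i => sum_n_m (fun j =>
       nodal n (p + Z.of_nat i)%Z (q + Z.of_nat j)%Z ^ 2) 0 3) 0 3).
  set (c := 2 * (13 * B * hc ^ 4) ^ 2).
  assert (Eg : cell_sum M1 M2 g = 16 * cell_sum M1 M2 (fun p q => nodal n p q ^ 2)).
  { unfold g. rewrite cell_sum_sum_four, sum_four.
    assert (forall i, cell_sum M1 M2 (fun a b => sum_n_m (fun j =>
       nodal n (a + Z.of_nat i)%Z (b + Z.of_nat j)%Z ^ 2) 0 3)
       = 4 * cell_sum M1 M2 (fun p q => nodal n p q ^ 2)) as Hi.
    { intros i. rewrite cell_sum_sum_four, sum_four.
      rewrite !(fun j => cell_sum_translate M1 M2 (fun p q => nodal n p q ^ 2) i j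
         (periodic_map (fun x => x ^ 2) _ _ _ HP)). ring. }
    rewrite !Hi. ring. }
  assert (X : cell_sum (kh * M1) (kh * M2) (fun a b => (U n a b - uf n a b) ^ 2) <=
    INR kh ^ 2 * cell_sum M1 M2 (fun p q => c + 2592 * g p q)).
  { rewrite <- cell_sum_refine by assumption. apply cell_sum_le_in. intros a b Ha Hb.
    destruct (div_mod_cell _ _ _ kh_pos Ha) as (Ea & Hp & Hl).
    destruct (div_mod_cell _ _ _ kh_pos Hb) as (Eb & Hq & Hm).
    pose proof (interpolation_pointwise n _ _ _ _ Hn Hp Hq Hl Hm) as Y.
    unfold K in Y. rewrite <- Ea, <- Eb in Y. exact Y. }
  rewrite cell_sum_plus, cell_sum_const, cell_sum_scal, Eg in X.
  apply Rmult_le_compat_l with (r := hf ^ 2) in X; [|apply pow2_ge_0].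
  eapply Rle_trans; [exact X|]. apply Req_le. rewrite E1, E2. unfold hf. field. lra.
Qed.

Variables (uc : nat -> gridfun) (D : R).
Let Uc := sample hc tauc u.
Let e (r : nat) : gridfun := fun p q => Uc r p q - uc r p q.

Hypothesis linear_t : forall x y a b th, Rabs x <= 10 * L1 -> Rabs y <= 10 * L2 ->
  0 <= a -> a <= b -> b <= T -> 0 <= th <= 1 ->
  Rabs (u x y (a + th * (b - a)) - ((1 - th) * u x y a + th * u x y b)) <= B * (b - a) ^ 2.
Hypothesis interpolates_in_time : forall (r s : nat) (p q : Z),
  (1 <= r <= N)%nat -> (s <= kt)%nat -> in_Omega M1 M2 p q ->
  uf ((r - 1) * kt + s)%nat (p * K)%Z (q * K)%Z =
    (1 - INR s / INR kt) * uc (r - 1)%nat p q + INR s / INR kt * uc r p q.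
Hypotheses (Uc_periodic : in_V M1 M2 N Uc) (uc_periodic : in_V M1 M2 N uc).
Hypothesis coarse_error : forall r, (r <= N)%nat ->
  hc ^ 2 * cell_sum M1 M2 (fun p q => e r p q ^ 2) <= D.

(** At a coarse node the error is the defect of linear interpolation of [u] plus a convex
    combination of two coarse errors. Convexity of the square keeps the latter below the sum of the
    two squares. *)
Lemma nodal_norm n : (n <= kt * N)%nat ->
  hc ^ 2 * cell_sum M1 M2 (fun p q => nodal n p q ^ 2) <=
  2 * (B * tauc ^ 2) ^ 2 * (L1 * L2) + 4 * D.
Proof.
  intros Hn. pose proof grid_facts
    as (G1 & G2 & G3 & G4 & G5 & G6 & G7 & G8 & G9 & G10 & G11 & G12).
  destruct grid as (H1 & H2 & H3 & _ & E1 & E2 & _).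
  assert (Hrs : exists r s, (1 <= r <= N)%nat /\ (s <= kt)%nat /\ n = ((r - 1) * kt + s)%nat).
  { destruct (Nat.eq_dec n (kt * N)) as [->|Hne].
    - exists N, kt. repeat split; try lia. nia.
    - exists (n / kt + 1)%nat, (n mod kt)%nat.
      pose proof (Nat.div_mod n kt ltac:(lia)). pose proof (Nat.mod_upper_bound n kt ltac:(lia)).
      assert (n / kt < N)%nat by (apply Nat.Div0.div_lt_upper_bound; lia).
      repeat split; try lia. }
  destruct Hrs as (r & s & Hr & Hs & En).
  assert (Per : forall r, (r <= N)%nat -> periodic M1 M2 (e r)).
  { intros k Hk. apply (periodic_map2 Rminus); auto. }
  assert (Pt : forall p q, nodal n p q ^ 2 <=
     2 * (B * tauc ^ 2) ^ 2 + 1 * (2 * e (r - 1)%nat p q ^ 2 + 2 * e r p q ^ 2)).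
  { pose proof (Per r ltac:(lia)) as P1. pose proof (Per (r - 1)%nat ltac:(lia)) as P2.
    pose proof (nodal_periodic n Hn) as P3.
    apply (periodic_le_Omega M1 M2); auto.
    { now apply (periodic_map (fun x => x ^ 2)). }
    { now apply (periodic_map2
        (fun x y => 2 * (B * tauc ^ 2) ^ 2 + 1 * (2 * x ^ 2 + 2 * y ^ 2))). }
    intros p q Ho. pose proof (interpolates_in_time r s p q Hr Hs Ho) as HI. rewrite <- En in HI.
    set (th := INR s / INR kt) in *.
    assert (Hth : 0 <= th <= 1).
    { apply le_INR in Hs. pose proof (pos_INR s). unfold th. split.
      - apply Rmult_le_pos; [lra|left; now apply Rinv_0_lt_compat].
      - apply Rmult_le_reg_r with (INR kt); [assumption|].
        replace (INR s / INR kt * INR kt) with (INR s) by (field; lra). lra. }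
    destruct Ho as [[Hp1 Hp2] [Hq1 Hq2]]. apply IZR_le in Hp1, Hp2, Hq1, Hq2.
    rewrite <- INR_IZR_INZ in Hp2, Hq2.
    assert (Hx : 0 <= IZR p * hc <= L1) by (rewrite E1; nra).
    assert (Hy : 0 <= IZR q * hc <= L2) by (rewrite E2; nra).
    set (x := IZR p * hc) in *. set (y := IZR q * hc) in *.
    assert (Hr1 : INR r = INR (r - 1) + 1) by (rewrite minus_INR by lia; simpl; ring).
    assert (HrN : INR r <= INR N) by (apply le_INR; lia).
    pose proof (pos_INR (r - 1)) as Hr0.
    pose proof (linear_t x y (INR (r - 1) * tauc) (INR r * tauc) th
      ltac:(rewrite Rabs_pos_eq; lra) ltac:(rewrite Rabs_pos_eq; lra)
      ltac:(nra) ltac:(nra) ltac:(nra) Hth) as HL.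
    assert (Et : INR n * tauf = INR (r - 1) * tauc + th * (INR r * tauc - INR (r - 1) * tauc)).
    { rewrite Hr1, En, plus_INR, mult_INR. unfold tauf, th. field. lra. }
    replace (INR r * tauc - INR (r - 1) * tauc) with tauc in * by (rewrite Hr1; ring).
    rewrite <- Et in HL.
    set (X := u x y (INR n * tauf) - _) in HL.
    assert (EN : nodal n p q = X + ((1 - th) * e (r - 1)%nat p q + th * e r p q)).
    { unfold nodal, e. rewrite HI. unfold X, U, Uc, sample.
      rewrite !coarse_node. fold x y. ring. }
    rewrite EN. set (a := e (r - 1)%nat p q). set (b := e r p q).
    assert (HX2 : X ^ 2 <= (B * tauc ^ 2) ^ 2).
    { rewrite <- pow2_abs. apply pow_incr. split; [apply Rabs_pos|assumption]. }
    assert (((1 - th) * a + th * b) ^ 2 <= (1 - th) * a ^ 2 + th * b ^ 2).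
    { pose proof (Rmult_le_pos (th * (1 - th)) ((a - b) ^ 2)
        ltac:(apply Rmult_le_pos; lra) (pow2_ge_0 _)). nra. }
    pose proof (pow2_ge_0 a). pose proof (pow2_ge_0 b).
    assert ((1 - th) * a ^ 2 <= a ^ 2) by nra. assert (th * b ^ 2 <= b ^ 2) by nra.
    pose proof (pow2_ge_0 (X - ((1 - th) * a + th * b))). lra. }
  pose proof (cell_sum_le M1 M2 _ _ Pt) as X.
  rewrite cell_sum_plus, cell_sum_const, cell_sum_scal, sum_lin2 in X.
  apply Rmult_le_compat_l with (r := hc ^ 2) in X; [|apply pow2_ge_0].
  pose proof (coarse_error r ltac:(lia)). pose proof (coarse_error (r - 1)%nat ltac:(lia)).
  eapply Rle_trans; [exact X|]. rewrite E1, E2. lra.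
Qed.

End Interpolation.

(** * The exact solution sampled on a grid *)

Lemma Dxx_periodic T L1 L2 u :
  (forall x y t, 0 <= t <= T -> u x y t = u (x + L1) y t /\ u x y t = u x (y + L2) t) ->
  forall x y t, 0 <= t <= T ->
    Dxx u x y t = Dxx u (x + L1) y t /\ Dxx u x y t = Dxx u x (y + L2) t.
Proof.
  intros H x y t Ht. unfold Dxx. split.
  - rewrite <- (Derive_n_comp_trans (fun z => u z y t) 2 x L1).
    apply Derive_n_ext. intros z. now apply H.
  - apply Derive_n_ext. intros z. now apply H.
Qed.

Lemma Dyy_periodic T L1 L2 u :
  (forall x y t, 0 <= t <= T -> u x y t = u (x + L1) y t /\ u x y t = u x (y + L2) t) ->
  forall x y t, 0 <= t <= T ->
    Dyy u x y t = Dyy u (x + L1) y t /\ Dyy u x y t = Dyy u x (y + L2) t.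
Proof.
  intros H x y t Ht. unfold Dyy. split.
  - apply Derive_n_ext. intros z. now apply H.
  - rewrite <- (Derive_n_comp_trans (fun z => u x z t) 2 y L2).
    apply Derive_n_ext. intros z. now apply H.
Qed.

Lemma grid_time L1 L2 T h tau M1 M2 N d : 0 < T ->
  is_grid L1 L2 T h tau M1 M2 N -> (d <= N)%nat -> 0 <= INR d * tau <= T.
Proof.
  intros HT (_ & _ & HN & _ & _ & _ & E) Hd. apply le_INR in HN, Hd. simpl in HN.
  assert (0 < tau) by (rewrite E; apply Rdiv_lt_0_compat; lra).
  split; [apply Rmult_le_pos; [apply pos_INR|lra]|].
  replace T with (INR N * tau) by (rewrite E; field; lra).
  apply Rmult_le_compat_r; lra.
Qed.

Lemma sample_periodic L1 L2 T h tau M1 M2 N g : 0 < T ->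
  is_grid L1 L2 T h tau M1 M2 N ->
  (forall x y t, 0 <= t <= T -> g x y t = g (x + L1) y t /\ g x y t = g x (y + L2) t) ->
  in_V M1 M2 N (sample h tau g).
Proof.
  intros HT Hg Hper d Hd a b. pose proof (grid_time _ _ _ _ _ _ _ _ _ HT Hg Hd) as Ht.
  destruct Hg as (_ & _ & _ & _ & E1 & E2 & _).
  unfold sample. rewrite !plus_IZR, <- !INR_IZR_INZ, !Rmult_plus_distr_r.
  rewrite (Rmult_comm (INR M1)), (Rmult_comm (INR M2)), <- E1, <- E2.
  split; symmetry; now apply Hper.
Qed.

(** The bounds on [u] hold on a box only, so they are checked at the nodes of [in_Omega], whose
    neighbours stay within two periods, and then extended by periodicity. The centred quotient spans
    [2 * h], which makes the Lipschitz constant its bound. *)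
Lemma sample_bounds L1 L2 T h tau M1 M2 N u B : 0 < T -> 0 <= B ->
  is_grid L1 L2 T h tau M1 M2 N ->
  in_V M1 M2 N (sample h tau u) ->
  (forall x y t, Rabs x <= 10 * L1 -> Rabs y <= 10 * L2 -> 0 <= t <= T ->
     Rabs (u x y t) <= B) ->
  (forall x x' y t, Rabs x <= 3 * L1 -> Rabs x' <= 3 * L1 -> Rabs y <= 10 * L2 ->
     0 <= t <= T -> Rabs (u x' y t - u x y t) <= B * Rabs (x' - x)) ->
  (forall x y y' t, Rabs x <= 10 * L1 -> Rabs y <= 3 * L2 -> Rabs y' <= 3 * L2 ->
     0 <= t <= T -> Rabs (u x y' t - u x y t) <= B * Rabs (y' - y)) ->
  forall d a b, (d <= N)%nat ->
    Rabs (sample h tau u d a b) <= B /\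
    forall dir, Rabs (hat dir h (sample h tau u d) a b) <= B.
Proof.
  intros HT HB Hg HP B0 Bx By d a b Hd.
  pose proof (grid_time _ _ _ _ _ _ _ _ _ HT Hg Hd) as Ht.
  destruct Hg as (H1 & H2 & _ & Hh & E1 & E2 & _).
  assert (HM1 := le_INR _ _ H1). assert (HM2 := le_INR _ _ H2). simpl in HM1, HM2.
  pose proof (HP d Hd) as PU.
  assert (Hx : forall a b, in_Omega M1 M2 a b ->
     h <= IZR a * h <= L1 /\ h <= IZR b * h <= L2).
  { intros p q [[Hp1 Hp2] [Hq1 Hq2]]. apply IZR_le in Hp1, Hp2, Hq1, Hq2.
    rewrite <- INR_IZR_INZ in Hp2, Hq2. rewrite E1, E2. nra. }
  assert (HL1 : h <= L1) by nra. assert (HL2 : h <= L2) by nra.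
  split; [|intros dir]; revert a b.
  - apply (periodic_le_Omega M1 M2 (fun a b => Rabs (sample h tau u d a b)) (fun _ _ => B)); auto.
    + now apply (periodic_map Rabs).
    + now intros ? ?.
    + intros a b Ho. destruct (Hx a b Ho). apply B0; auto; rewrite Rabs_pos_eq; lra.
  - apply (periodic_le_Omega M1 M2 (fun a b => Rabs (hat dir h (sample h tau u d) a b))
      (fun _ _ => B)); auto.
    + apply (periodic_map Rabs). eapply periodic_ext; [intros; apply hatE|]. periodicity.
    + now intros ? ?.
    + intros a b Ho. destruct (Hx a b Ho).
      assert (Hdiv : forall z, Rabs z <= B * (2 * h) -> Rabs (z / (2 * h)) <= B).
      { intros z Hz. unfold Rdiv. rewrite Rabs_mult, Rabs_inv, (Rabs_pos_eq (2 * h)) by lra.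
        apply Rmult_le_reg_r with (2 * h); [lra|].
        rewrite Rmult_assoc, Rinv_l, Rmult_1_r by lra. exact Hz. }
      rewrite hatE. apply Hdiv. unfold fwd, bwd, sample. destruct dir.
      * rewrite plus_IZR, minus_IZR. eapply Rle_trans.
        { apply Bx; auto; rewrite Rabs_pos_eq; lra. }
        apply Rmult_le_compat_l; [assumption|]. rewrite Rabs_pos_eq; lra.
      * rewrite plus_IZR, minus_IZR. eapply Rle_trans.
        { apply By; auto; rewrite Rabs_pos_eq; lra. }
        apply Rmult_le_compat_l; [assumption|]. rewrite Rabs_pos_eq; lra.
Qed.

Lemma is_grid_refine L1 L2 T hc tauc M1 M2 N kh kt :
  (1 <= kh)%nat -> (1 <= kt)%nat -> is_grid L1 L2 T hc tauc M1 M2 N ->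
  is_grid L1 L2 T (hc / INR kh) (tauc / INR kt) (kh * M1) (kh * M2) (kt * N).
Proof.
  intros Hk Ht (H1 & H2 & H3 & Hh & E1 & E2 & E3).
  assert (Hk' := le_INR _ _ Hk). assert (Ht' := le_INR _ _ Ht).
  assert (HN := le_INR _ _ H3). simpl in Hk', Ht', HN.
  unfold is_grid. rewrite !mult_INR. repeat split; try nia.
  - apply Rdiv_lt_0_compat; lra.
  - rewrite E1. field. lra.
  - rewrite E2. field. lra.
  - rewrite E3. field. lra.
Qed.

(** * Assembly of the coarse estimate, the interpolation and the fine estimate *)

Theorem theorem4p4 :
  forall (lambda T L1 L2 : R) (kh kt : nat)
         (u0 : R -> R -> R) (u : R -> R -> R -> R) (c0 : R),
  0 < lambda -> 0 < T -> 0 < L1 -> 0 < L2 ->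
  (1 <= kh)%nat -> (1 <= kt)%nat ->
  exact_solution lambda T L1 L2 u0 u ->
  C42 T u ->
  consistent lambda T L1 L2 u ->
  is_c0 T L1 L2 u c0 ->
  exists Ct : R, 0 < Ct /\
    forall (hc tauc hf tauf : R) (M1c M2c Nc : nat),
    is_grid L1 L2 T hc tauc M1c M2c Nc ->
    hf = hc / INR kh ->
    tauf = tauc / INR kt ->
    forall uc vc wc uf vf wf un vn wn : nat -> gridfun,
    coarse_solution lambda hc tauc M1c M2c Nc u0 uc vc wc ->
    interpolated_fields kh kt hf M1c M2c Nc uc uf vf wf ->
    fine_solution lambda hf tauf (kh * M1c) (kh * M2c) (kt * Nc) u0
      uf vf wf un vn wn ->
    tauf <= 2 / (3 * c_1 lambda c0 hf) ->
    forall n : nat, (1 <= n <= kt * Nc)%nat ->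
      norm_h hf (kh * M1c) (kh * M2c)
        (fun i j => u (IZR i * hf) (IZR j * hf) (INR n * tauf) - un n i j)
      <= Ct * (tauf ^ 2 + hf ^ 4).
Proof.
  intros lambda T L1 L2 kh kt u0 u c0 Hl HT HL1 HL2 Hkh Hkt (_ & Hini & Hper) Hreg [C0 HC] _.
  destruct (smooth_bounds T L1 L2 u HT HL1 HL2 Hreg)
    as (B & HB & B0 & Bx & By & Cx & Cy & Lt).
  set (C := Rabs C0). assert (HC0 : 0 <= C) by apply Rabs_pos.
  assert (Harea : 0 <= L1 * L2) by nra.
  (* All that [scheme_convergence] asks of the exact solution, stated for an arbitrary grid so as to
     apply to the coarse and the fine one. *)
  assert (Grid : forall h tau M1 M2 N, is_grid L1 L2 T h tau M1 M2 N ->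
    (0 < h /\ h <= L1 /\ 0 < tau /\ (1 <= M1)%nat /\ (1 <= M2)%nat /\
     INR N * tau = T /\ h ^ 2 * (INR M1 * INR M2) = L1 * L2) /\
    let U := sample h tau u in let V := sample h tau (Dxx u) in let W := sample h tau (Dyy u) in
    let rho := tau ^ 2 + h ^ 4 in
    tau ^ 2 <= rho /\ in_V M1 M2 N U /\ in_V M1 M2 N V /\ in_V M1 M2 N W /\
    (forall a b, U 0%nat a b = u0 (IZR a * h) (IZR b * h)) /\
    (forall n a b, (n <= N)%nat -> Rabs (U n a b) <= B) /\
    (forall n d a b, (n <= N)%nat -> Rabs (hat d h (U n) a b) <= B) /\
    (forall n a b, (1 <= n <= N)%nat ->
       Rabs (momentum lambda h tau U V W U V W n a b) <= C * rho) /\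
    (forall n a b, (n <= N)%nat ->
       Rabs (V n a b - compact_x h (U n) (V n) a b) <= C * rho /\
       Rabs (W n a b - compact_y h (U n) (W n) a b) <= C * rho)).
  { intros h tau M1 M2 N Hg. pose proof Hg as (H1 & H2 & H3 & Hh & E1 & E2 & E3).
    pose proof (le_INR _ _ H1) as H1'. pose proof (le_INR _ _ H2) as H2'.
    pose proof (le_INR _ _ H3) as H3'. simpl in H1', H2', H3'.
    assert (Ht : 0 < tau) by (rewrite E3; apply Rdiv_lt_0_compat; lra).
    assert (HLh : h <= L1) by nra.
    pose proof (sample_periodic L1 L2 T h tau M1 M2 N u HT Hg Hper) as PU.
    pose proof (fun d a b Hd => sample_bounds L1 L2 T h tau M1 M2 N u B HT HB Hg PU B0 Bx By
      d a b Hd) as BU.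
    assert (Hh4 : 0 <= h ^ 4) by (apply pow_le; lra).
    pose proof (pow2_ge_0 tau) as Ht2.
    assert (HCC : C0 <= C) by apply Rle_abs.
    destruct (HC h tau M1 M2 N Hg) as [HC1 HC2].
    split; [|cbv zeta; split; [|split; [|split; [|split; [|split; [|split; [|split; [|split]]]]]]]].
    - repeat split; auto; [rewrite E3; field; lra|rewrite E1, E2; ring].
    - lra.
    - exact PU.
    - apply (sample_periodic L1 L2 T); auto. now apply Dxx_periodic.
    - apply (sample_periodic L1 L2 T); auto. now apply Dyy_periodic.
    - intros a b. unfold sample. simpl INR. rewrite Rmult_0_l. apply Hini.
    - intros n a b Hn. now apply BU.
    - intros n d a b Hn. now apply BU.
    - intros n a b Hn. eapply Rle_trans; [now apply HC1|]. apply Rmult_le_compat_r; lra.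
    - intros n a b Hn. destruct (HC2 n a b Hn) as [X1 X2].
      assert (C0 * h ^ 4 <= C * h ^ 4) by (apply Rmult_le_compat_r; lra).
      assert (0 <= C * tau ^ 2) by (apply Rmult_le_pos; lra). lra. }
  (* On the coarse grid the advecting error is the error itself, and its midpoint mean is bounded by
     the two levels, so [D = 1] suffices. *)
  destruct (scheme_convergence lambda B L1 C 1 T (L1 * L2) Hl HB HC0 ltac:(lra) Harea)
    as (Kc & HKc & Coarse).
  (* [338 = 2 * 13 ^ 2] and 41472 come from [interpolation_norm]; the last bracket is [nodal_norm]
     with the coarse bound [Kc * rc ^ 2], everything divided by [rc ^ 2]. *)
  set (Dc := 338 * B ^ 2 * (L1 * L2) + 41472 * (2 * B ^ 2 * (L1 * L2) + 4 * Kc)).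
  assert (HBA : 0 <= B ^ 2 * (L1 * L2)) by (apply Rmult_le_pos; [apply pow2_ge_0|assumption]).
  assert (HDc : 0 <= Dc) by (unfold Dc; lra).
  (* The extra factor converts the coarse order into the fine one, as [tauc = kt * tauf] and
     [hc = kh * hf]. *)
  set (Df := Dc * (INR kt ^ 2 + INR kh ^ 4) ^ 2).
  assert (HDf : 0 <= Df) by (apply Rmult_le_pos; [assumption|apply pow2_ge_0]).
  destruct (scheme_convergence lambda B L1 C Df T (L1 * L2) Hl HB HC0 HDf Harea)
    as (Kf & HKf & Fine).
  exists (sqrt Kf). split; [now apply sqrt_lt_R0|].
  intros hc tauc hf tauf M1 M2 N Hgc -> -> uc vc wc uf vf wf un vn wn Hcs
    ((Puf & It & Is) & Pvf & Pwf & Rf) Hfs _ n Hn.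
  pose proof (is_grid_refine _ _ _ _ _ _ _ _ kh kt Hkh Hkt Hgc) as Hgf.
  set (hf := hc / INR kh) in *. set (tauf := tauc / INR kt) in *.
  destruct (Grid _ _ _ _ _ Hgc) as
    ((c1 & c2 & c3 & c4 & c5 & c6 & c7) & d1 & d2 & d3 & d4 & d5 & d6 & d7 & d8 & d9).
  destruct (Grid _ _ _ _ _ Hgf) as
    ((f1 & f2 & f3 & f4 & f5 & f6 & f7) & g1 & g2 & g3 & g4 & g5 & g6 & g7 & g8 & g9).
  clear Grid.
  pose proof Hcs as (Puc & Pvc & Pwc & _ & Rc & _).
  pose proof Hfs as (Pun & _).
  set (rc := tauc ^ 2 + hc ^ 4) in *. set (rf := tauf ^ 2 + hf ^ 4) in *.
  assert (Ec : forall r, (r <= N)%nat -> hc ^ 2 * cell_sum M1 M2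
     (fun a b => (sample hc tauc u r a b - uc r a b) ^ 2) <= Kc * rc ^ 2).
  { apply (Coarse hc tauc M1 M2 N u0 (sample hc tauc u) (sample hc tauc (Dxx u))
      (sample hc tauc (Dyy u)) uc vc wc uc vc wc rc); auto.
    intros r Hr.
    pose proof (mid_sq_le M1 M2 (fun n a b => sample hc tauc u n a b - uc n a b) r) as X.
    apply Rmult_le_compat_l with (r := hc ^ 2) in X; [|apply pow2_ge_0].
    assert (Hnn : forall k, 0 <= hc ^ 2 * cell_sum M1 M2
      (fun a b => (sample hc tauc u k a b - uc k a b) ^ 2)).
    { intros k. apply Rmult_le_pos; [apply pow2_ge_0|apply cell_sum_sq_nonneg]. }
    pose proof (Hnn r). pose proof (Hnn (r - 1)%nat). pose proof (pow2_ge_0 rc). lra. }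
  assert (Hrc : rc ^ 2 <= (INR kt ^ 2 + INR kh ^ 4) ^ 2 * rf ^ 2).
  { pose proof (le_INR _ _ Hkh) as k1. pose proof (le_INR _ _ Hkt) as k2. simpl in k1, k2.
    rewrite <- Rpow_mult_distr. apply pow_incr.
    pose proof (pow2_ge_0 tauc). pose proof (pow_le hc 4 ltac:(lra)). split; [unfold rc; lra|].
    assert (tauc = INR kt * tauf) as Et by (unfold tauf; field; lra).
    assert (hc = INR kh * hf) as Eh by (unfold hf; field; lra).
    unfold rc, rf. rewrite Et, Eh, !Rpow_mult_distr.
    pose proof (pow2_ge_0 tauf). pose proof (pow_le hf 4 ltac:(lra)).
    pose proof (pow2_ge_0 (INR kt)). pose proof (pow_le (INR kh) 4 ltac:(lra)).
    pose proof (Rmult_le_pos (INR kt ^ 2) (hf ^ 4)).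
    pose proof (Rmult_le_pos (INR kh ^ 4) (tauf ^ 2)). lra. }
  assert (Interp : forall k, (k <= kt * N)%nat ->
     hf ^ 2 * cell_sum (kh * M1) (kh * M2) (fun a b => (sample hf tauf u k a b - uf k a b) ^ 2)
     <= Df * rf ^ 2).
  { intros k Hk.
    pose proof (interpolation_norm T L1 L2 B u kh kt hc tauc M1 M2 N uf Hkh Hkt HB HT Hgc
      Puf g2 Cx Cy Is k Hk) as X1.
    pose proof (nodal_norm T L1 L2 B u kh kt hc tauc M1 M2 N uf Hkh Hkt HT Hgc Puf g2
      uc (Kc * rc ^ 2) Lt It d2 Puc Ec k Hk) as X2.
    fold hf tauf in X1, X2.
    assert (Hq1 : (hc ^ 4) ^ 2 <= rc ^ 2).
    { apply pow_incr. pose proof (pow2_ge_0 tauc). pose proof (pow_le hc 4 ltac:(lra)).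
      unfold rc; lra. }
    assert (Hq2 : (tauc ^ 2) ^ 2 <= rc ^ 2).
    { apply pow_incr. pose proof (pow2_ge_0 tauc). pose proof (pow_le hc 4 ltac:(lra)).
      unfold rc; lra. }
    pose proof (Rmult_le_compat_l _ _ _ HBA Hq1). pose proof (Rmult_le_compat_l _ _ _ HBA Hq2).
    apply Rle_trans with (Dc * rc ^ 2); [unfold Dc; lra|].
    unfold Df. rewrite Rmult_assoc. now apply Rmult_le_compat_l. }
  rewrite norm_h_cell_sum.
  2: { apply (periodic_map2 Rminus (kh * M1) (kh * M2) (sample hf tauf u n) (un n));
         [apply g2|apply Pun]; lia. }
  assert (Hrf : 0 <= rf) by (pose proof (pow2_ge_0 tauf); lra).
  rewrite <- (sqrt_pow2 rf Hrf), <- sqrt_mult by (lra || apply pow2_ge_0).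
  apply sqrt_le_1_alt.
  apply (Fine hf tauf (kh * M1)%nat (kh * M2)%nat (kt * N)%nat u0 (sample hf tauf u)
    (sample hf tauf (Dxx u)) (sample hf tauf (Dyy u)) uf vf wf un vn wn rf); auto; [|lia].
  intros k Hk.
  pose proof (mid_sq_le (kh * M1) (kh * M2) (fun n a b => sample hf tauf u n a b - uf n a b) k) as X.
  apply Rmult_le_compat_l with (r := hf ^ 2) in X; [|apply pow2_ge_0].
  assert (Hnn : forall k, 0 <= Df * (hf ^ 2 * cell_sum (kh * M1) (kh * M2)
      (fun a b => (sample hf tauf u k a b - un k a b) ^ 2))).
  { intros j. apply Rmult_le_pos; [assumption|].
    apply Rmult_le_pos; [apply pow2_ge_0|apply cell_sum_sq_nonneg]. }
  pose proof (Hnn k). pose proof (Hnn (k - 1)%nat).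
  pose proof (Interp k ltac:(lia)). pose proof (Interp (k - 1)%nat ltac:(lia)). lra.
Qed.
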